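(* Let $h,\tilde h$ be bounded functions on $\Omega\cup\Gamma_N$ with $h$ upper semicontinuous and $\tilde h$ lower semicontinuous, such that $h\le\tilde h$ and at least one of the following holds: $h<\tilde h$ everywhere; $h\equiv0$; $\tilde h>0$ everywhere. Suppose $u\in USC(\bar\Omega)$ is a viscosity subsolution of $$-\Delta_\infty u-\beta|Du|\le h\text{ in }\Omega,\qquad D_\nu u\le0\text{ on }\Gamma_N,$$ and $v\in LSC(\bar\Omega)$ is a viscosity supersolution of $$-\Delta_\infty v-\beta|Dv|\ge \tilde h\text{ in }\Omega,\qquad D_\nu v\ge0\text{ on }\Gamma_N.$$ Then $\max_{\bar\Omega}(u-v)=\max_{\Gamma_D}(u-v)$.
   Context: Standing setting: $\Omega\subseteq\mathbb{R}^n$ is a bounded, open, connected set with $C^1$ boundary; $\nu$ is the outward unit normal. For some open $A\subseteq\mathbb{R}^n$, $\Gamma_N:=\partial\Omega\cap A$, $\Gamma_D:=\partial\Omega\setminus A\neq\emptyset$. If $\Gamma_N\ne\emptyset$, $\Omega$ is convex. $\beta\in\mathbb{R}$. For $\varphi\in C^2$: $\Delta_\infty^+\varphi(x):=|D\varphi|^{-2}\langle D^2\varphi D\varphi,D\varphi\rangle(x)$ if $D\varphi(x)\ne0$, else $\max_{|v|=1}\langle D^2\varphi(x)v,v\rangle$; $\Delta^-_\infty\varphi:=-\Delta^+_\infty(-\varphi)$. Subsolution (for $h$ USC on $\Omega\cup\Gamma_N$): $u$ USC such that for every $\varphi\in C^2(\bar\Omega)$ and $x_0\in\Omega\cup\Gamma_N$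 where $u-\varphi$ has a local maximum relative to $\bar\Omega$: $-\Delta^+_\infty\varphi(x_0)-\beta|D\varphi(x_0)|\le h(x_0)$, or $x_0\in\Gamma_N$ and $D\varphi(x_0)\cdot\nu(x_0)\le0$. Supersolution (for $\tilde h$ LSC on $\Omega\cup\Gamma_N$): $v$ LSC such that for every $\varphi\in C^2(\bar\Omega)$ and $x_0\in\Omega\cup\Gamma_N$ where $v-\varphi$ has a local minimum relative to $\bar\Omega$: $-\Delta^-_\infty\varphi(x_0)-\beta|D\varphi(x_0)|\ge \tilde h(x_0)$, or $x_0\in\Gamma_N$ and $D\varphi(x_0)\cdot\nu(x_0)\ge0$. *)

(* Defs.v *)
From HB Require Import structures.
From mathcomp Require Import all_boot all_order all_algebra.
From mathcomp Require Import all_classical all_reals all_analysis.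
Set Implicit Arguments. Unset Strict Implicit. Unset Printing Implicit Defensive.
Import Order.TTheory GRing.Theory Num.Theory.
Import numFieldNormedType.Exports.
Local Open Scope classical_set_scope.
Local Open Scope ring_scope.

Section PLDefs.
Context {R : realType} {n : nat}.
Local Notation V := 'rV[R]_n.

Definition evec (i : 'I_n) : V := delta_mx 0 i.
Definition dotp (x y : V) : R := \sum_(i < n) x 0 i * y 0 i.
Definition enorm (x : V) : R := Num.sqrt (dotp x x).

Definition pderiv (i : 'I_n) (f : V -> R) (x : V) : R := 'D_(evec i) f x.
Definition grad (f : V -> R) (x : V) : V := \row_(i < n) pderiv i f x.
Definition hess (f : V -> R) (x : V) : 'M[R]_n :=
  \matrix_(i < n, j < n) pderiv j (pderiv i f) x.
Definition quadf (H : 'M[R]_n) (v : V) : R :=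
  \sum_(i < n) \sum_(j < n) H i j * v 0 j * v 0 i.

Definition C2 (f : V -> R) : Prop :=
  continuous f /\
  (forall i x, derivable f x (evec i)) /\
  (forall i, continuous (pderiv i f)) /\
  (forall i j x, derivable (pderiv i f) x (evec j)) /\
  (forall i j, continuous (pderiv j (pderiv i f))).

Definition C1_on (U : set V) (f : V -> R) : Prop :=
  forall x, U x -> {for x, continuous f} /\
    forall i, derivable f x (evec i) /\ {for x, continuous (pderiv i f)}.

Definition inf_lap_plus (phi : V -> R) (x : V) : R :=
  if grad phi x != 0 then
    quadf (hess phi x) (grad phi x) / (enorm (grad phi x)) ^+ 2
  else sup [set quadf (hess phi x) v | v in [set v : V | enorm v = 1]].
Definition inf_lap_minus (phi : V -> R) (x : V) : R :=
  - inf_lap_plus (fun y => - phi y) x.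

Definition bdry (O : set V) : set V := closure O `\` interior O.
Definition GammaN (O A : set V) : set V := bdry O `&` A.
Definition GammaD (O A : set V) : set V := bdry O `\` A.
Definition bounded_setV (O : set V) : Prop := exists M : R, forall x, O x -> `|x| <= M.
Definition convex_setV (O : set V) : Prop :=
  forall x y (t : R), O x -> O y -> 0 <= t <= 1 -> O ((1 - t) *: x + t *: y).

(* C^1 boundary, with nu the outward unit normal: near every boundary point
   O is the sublevel set {rho < 0} of a C^1 function with nonvanishing gradient,
   and nu = D rho / |D rho| on the boundary *)
Definition C1_boundary_normal (O : set V) (nu : V -> V) : Prop :=
  forall x0, bdry O x0 -> exists (U : set V) (rho : V -> R),
    [/\ open U, U x0, C1_on U rho,
        (forall x, U x -> grad rho x != 0) &
        ((forall x, U x -> (O x <-> rho x < 0)) /\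
         (forall x, U x -> bdry O x -> nu x = (enorm (grad rho x))^-1 *: grad rho x))].

Definition bounded_on (S : set V) (f : V -> R) : Prop :=
  exists M : R, forall x, S x -> `|f x| <= M.
Definition usc_on (S : set V) (f : V -> R) : Prop :=
  forall x, S x -> forall e : R, 0 < e ->
    exists2 d : R, 0 < d & forall y, S y -> `|y - x| < d -> f y < f x + e.
Definition lsc_on (S : set V) (f : V -> R) : Prop :=
  usc_on S (fun x => - f x).
Definition loc_max_rel (S : set V) (f : V -> R) (x0 : V) : Prop :=
  exists2 d : R, 0 < d & forall y, S y -> `|y - x0| < d -> f y <= f x0.
Definition loc_min_rel (S : set V) (f : V -> R) (x0 : V) : Prop :=
  exists2 d : R, 0 < d & forall y, S y -> `|y - x0| < d -> f x0 <= f y.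
Definition is_max_on (S : set V) (f : V -> R) (m : R) : Prop :=
  (exists2 x, S x & f x = m) /\ (forall y, S y -> f y <= m).

Definition subsolution (O A : set V) (nu : V -> V) (beta : R) (h u : V -> R) : Prop :=
  usc_on (closure O) u /\
  forall phi, C2 phi -> forall x0, (O `|` GammaN O A) x0 ->
    loc_max_rel (closure O) (fun y => u y - phi y) x0 ->
    (- inf_lap_plus phi x0 - beta * enorm (grad phi x0) <= h x0) \/
    (GammaN O A x0 /\ dotp (grad phi x0) (nu x0) <= 0).
Definition supersolution (O A : set V) (nu : V -> V) (beta : R) (ht v : V -> R) : Prop :=
  lsc_on (closure O) v /\
  forall phi, C2 phi -> forall x0, (O `|` GammaN O A) x0 ->
    loc_min_rel (closure O) (fun y => v y - phi y) x0 ->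
    (- inf_lap_minus phi x0 - beta * enorm (grad phi x0) >= ht x0) \/
    (GammaN O A x0 /\ dotp (grad phi x0) (nu x0) >= 0).

End PLDefs.

(* Main.v *)
Require Import Defs.
From HB Require Import structures.
From mathcomp Require Import all_boot all_order all_algebra.
From mathcomp Require Import all_classical all_reals all_analysis.
From mathcomp Require Import ring lra.
Set Implicit Arguments. Unset Strict Implicit. Unset Printing Implicit Defensive.
Import Order.TTheory GRing.Theory Num.Theory.
Import numFieldNormedType.Exports.
Local Open Scope classical_set_scope.
Local Open Scope ring_scope.

(** Instead of doubling variables and the theorem on sums, one compares [u] and
    [v] through a finite difference inequality.  Put [w := - v], a subsolution
    for [(- beta, - ht)].  For a subsolution, comparison with the radial solutions
    [g] of [- g'' - beta g' = H] on the ball of radius [2 e] about [x] gives, with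
    [u1], [u2] the maxima of [u] on the balls of radii [e], [2 e] about [x],
      [u1 - u x <= p (u2 - u x) + H k],   [p = 1 / (1 + exp (- beta e))],
    where [k > 0]; changing the sign of [beta] replaces [p] by [1 - p] and keeps
    [k].  If [u - v] exceeded its boundary maximum inside, maximize [u y + w z]
    over pairs at distance at most [2 e], and let [x] be the midpoint.  Moving
    either point of the pair through [x] shows that the increments of [u] and [w]
    at [x] are ordered in such a way that the two inequalities contradict each
    other when [h < ht].  When [h = 0] they force equality; choosing the pair with
    [u y] maximal makes [u] and [w] locally constant, and this propagates up to
    [GammaD] because [Omega] is connected.  The case [0 < ht] reduces to the strict
    one by replacing [v] with [(1 + t) v].  Convexity of [Omega] makes radially
    increasing test functions have positive normal derivative on [GammaN]. *)

(** * Radial solutions of the one-dimensional equation *)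

Section Cone.
Context {R : realType}.
Implicit Types (beta H b r x e : R).

(* [int_0^r exp (- beta s) ds], and its own primitive vanishing at [0]. *)
Definition expint beta r : R :=
  if beta == 0 then r else (1 - expR (- (beta * r))) / beta.

Definition expint2 beta r : R :=
  if beta == 0 then r ^+ 2 / 2 else (r - expint beta r) / beta.

(* The solution of [- f'' - beta f' = H] with [f 0 = 0] and [f' 0 = b]. *)
Definition cone beta H b r : R := b * expint beta r - H * expint2 beta r.

Definition dcone beta H b r : R :=
  b * expR (- (beta * r)) - H * expint beta r.

Lemma expR_expint beta r : expR (- (beta * r)) + beta * expint beta r = 1.
Proof.
rewrite /expint; case: eqVneq => [->|b0]; first by rewrite !mul0r oppr0 expR0 addr0.
by field.
Qed.

Lemma expint0 beta : expint beta 0 = 0.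
Proof. by rewrite /expint mulr0 oppr0 expR0 subrr mul0r; case: eqP. Qed.

Lemma expint20 beta : expint2 beta 0 = 0.
Proof.
by rewrite /expint2 expint0 subrr mul0r expr0n/= mul0r; case: eqP.
Qed.

Lemma is_derive_expR_lin beta x :
  is_derive x 1 (fun r => expR (- (beta * r))) (- beta * expR (- (beta * x))).
Proof.
have h : is_derive x 1 (fun r => - (beta * r)) (- beta).
  by apply: is_derive_eq; rewrite ?mulr1 ?scaler1 /GRing.scale/= ?mulr1.
have := @is_derive1_comp R expR (fun r => - (beta * r)) x _ _ (is_derive_expR _) h.
by rewrite mulrC.
Qed.

Lemma is_derive_expint beta x :
  is_derive x 1 (expint beta) (expR (- (beta * x))).
Proof.
rewrite /expint; case: (eqVneq beta 0) => [->|b0].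
  by rewrite mul0r oppr0 expR0; exact: is_derive_id.
have h := is_derive_expR_lin beta x.
have -> : (fun r => (1 - expR (- (beta * r))) / beta) =
  (fun r => beta^-1 *: (cst 1 - (fun r => expR (- (beta * r)))) r).
  by apply/funext => r; rewrite /= mulrC.
apply: is_derive_eq.
by rewrite /GRing.scale/= sub0r mulNr opprK mulKf.
Qed.

Lemma is_derive_expint2 beta x :
  is_derive x 1 (expint2 beta) (expint beta x).
Proof.
rewrite /expint2; case: (eqVneq beta 0) => [->|b0].
  have -> : (fun r => r ^+ 2 / 2) = (fun r => 2^-1 *: ((@id R) ^+ 2) r).
    by apply/funext => r; rewrite /= mulrC.
  apply: is_derive_eq.
  by rewrite /expint eqxx /GRing.scale/= expr1 mulr1; lra.
have h := is_derive_expint beta x.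
have -> : (fun r => (r - expint beta r) / beta) =
  (fun r => beta^-1 *: (id - expint beta) r).
  by apply/funext => r; rewrite /= mulrC.
apply: is_derive_eq.
rewrite /GRing.scale/= -{1}(expR_expint beta x) (addrC (expR _)) addrK mulrA.
by rewrite mulVf ?mul1r.
Qed.

Lemma cone0 beta H b : cone beta H b 0 = 0.
Proof. by rewrite /cone expint0 expint20; ring. Qed.

Lemma is_derive_cone beta H b x :
  is_derive x 1 (cone beta H b) (dcone beta H b x).
Proof.
have h1 := is_derive_expint beta x; have h2 := is_derive_expint2 beta x.
have -> : cone beta H b = (b *: expint beta) - (H *: expint2 beta) by [].
exact: is_derive_eq.
Qed.

Lemma is_derive_dcone beta H b x :
  is_derive x 1 (dcone beta H b) (- beta * dcone beta H b x - H).
Proof.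
have h1 := is_derive_expint beta x; have h2 := is_derive_expR_lin beta x.
apply: (is_derive_eq (is_deriveB (is_deriveZ b h2) (is_deriveZ H h1))).
rewrite /dcone /GRing.scale/=; have := expR_expint beta x.
set E := expR _; set G := expint _ _ => e.
by have -> : E = 1 - beta * G; [rewrite -e addrK | ring].
Qed.

Lemma derive_homo_lt (f df : R -> R) (x y : R) :
  (forall z : R, is_derive z 1 f (df z)) ->
  x < y -> (forall z, x < z < y -> 0 < df z) -> f x < f y.
Proof.
move=> fd xy dp.
have [|z + e] := @MVT R f df x y xy (fun z _ => fd z).
  apply: derivable_within_continuous => z _; exact: (@ex_derive _ _ _ _ _ _ _ (fd z)).
rewrite in_itv/= => zxy.
by rewrite -subr_gt0 e mulr_gt0 ?subr_gt0 ?dp.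
Qed.

Lemma derive_homo_le (f df : R -> R) (x y : R) :
  (forall z : R, is_derive z 1 f (df z)) ->
  x <= y -> (forall z, x < z < y -> 0 <= df z) -> f x <= f y.
Proof.
move=> fd; rewrite le_eqVlt => /predU1P[->//|xy] dp.
have [|z + e] := @MVT R f df x y xy (fun z _ => fd z).
  apply: derivable_within_continuous => z _; exact: (@ex_derive _ _ _ _ _ _ _ (fd z)).
rewrite in_itv/= => zxy.
by rewrite -subr_ge0 e mulr_ge0 ?dp// subr_ge0 ltW.
Qed.

Lemma expint_lt beta : {homo expint beta : x y / x < y}.
Proof.
move=> x y xy; apply: (derive_homo_lt (is_derive_expint beta)) => // z _.
exact: expR_gt0.
Qed.

Lemma expint_gt0 beta r : 0 < r -> 0 < expint beta r.
Proof. by move=> r0; rewrite -(expint0 beta) expint_lt. Qed.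

Lemma expint2_gt0 beta r : 0 < r -> 0 < expint2 beta r.
Proof.
move=> r0; rewrite -(expint20 beta).
apply: (derive_homo_lt (is_derive_expint2 beta)) => // z /andP[z0 _].
exact: expint_gt0.
Qed.

(** Substitute [r - s] for [s] in the integral. *)
Lemma expintN beta r : expint (- beta) r = expR (beta * r) * expint beta r.
Proof.
have b0 := expR_expint (- beta) r; have b1 := expR_expint beta r.
rewrite mulNr opprK in b0.
rewrite /expint oppr_eq0; case: eqVneq => [->|bn]; first by rewrite mul0r expR0 mul1r.
rewrite mulNr opprK expRN invrN mulrN -mulNr opprB mulrA mulrBr mulr1 mulfV//.
by rewrite gt_eqF// expR_gt0.
Qed.

(** With the positive exponential factored out, the sign of the slope is that of
    [b - H * expint (- beta) r], which is monotone in [r]. *)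
Lemma dconeE beta H b r :
  dcone beta H b r = expR (- (beta * r)) * (b - H * expint (- beta) r).
Proof.
rewrite expintN /dcone mulrBr (mulrC b); congr (_ - _).
by rewrite mulrCA mulrA mulrA -(mulrA H) -expRD addNr expR0 mulr1.
Qed.

(* The weight [expint beta e / expint beta (2 e)] and the constant with
   [cone beta H b e = fdp beta e * cone beta H b (2 e) + H * fdk beta e]. *)
Definition fdp beta e : R := (1 + expR (- (beta * e)))^-1.

Definition fdk beta e : R := fdp beta e * e * expint beta e.

Lemma fdp_gt0 beta e : 0 < fdp beta e.
Proof. by rewrite invr_gt0 addr_gt0// expR_gt0. Qed.

Lemma fdpN beta e : fdp (- beta) e = 1 - fdp beta e.
Proof.
rewrite /fdp mulNr opprK expRN.
have := expR_gt0 (beta * e); set E := expR _ => E0.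
by field; rewrite !gt_eqF ?addr_gt0.
Qed.

Lemma fdp_lt1 beta e : fdp beta e < 1.
Proof. by rewrite -subr_gt0 -fdpN fdp_gt0. Qed.

Lemma fdk_gt0 beta e : 0 < e -> 0 < fdk beta e.
Proof. by move=> e0; rewrite !mulr_gt0 ?fdp_gt0 ?expint_gt0. Qed.

(** For [beta != 0] the constant is [e / beta * tanh (beta * e / 2)], an even function of [beta]. *)
Lemma fdkN beta e : fdk (- beta) e = fdk beta e.
Proof.
rewrite /fdk expintN /fdp mulNr opprK expRN.
have := expR_gt0 (beta * e); set E := expR _ => E0.
by field; rewrite !gt_eqF ?addr_gt0.
Qed.

(** The integral over [[e, 2 * e]] is [expR (- (beta * e))] times the one over [[0, e]]. *)
Lemma expint_double beta e :
  expint beta (2 * e) * fdp beta e = expint beta e.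
Proof.
rewrite /fdp; have E0 := expR_gt0 (- (beta * e)).
have n0 : 1 + expR (- (beta * e)) != 0 by rewrite gt_eqF// addr_gt0.
apply: (mulIf n0); rewrite mulfVK// /expint; case: eqVneq => [->|b0].
  by rewrite mul0r oppr0 expR0 mulrC.
have -> : - (beta * (2 * e)) = - (beta * e) + - (beta * e) by ring.
by rewrite expRD; field.
Qed.

(** For [beta != 0] the [expint] terms cancel by [expint_double], and
    [(2 * fdp beta e - 1) * e / beta] is left. *)
Lemma expint2_double beta e :
  fdp beta e * expint2 beta (2 * e) - expint2 beta e = fdk beta e.
Proof.
have d := expint_double beta e.
rewrite /fdk; move: d; rewrite /expint2; have [b0|b0] := eqVneq beta 0.
  by rewrite b0 /expint /fdp eqxx mul0r oppr0 expR0 => _; field.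
move=> d; rewrite mulrA mulrBr (mulrC _ (expint _ (2 * e))) d.
have := expR_expint beta e; have := fdp_gt0 beta e; rewrite /fdp.
have E0 := expR_gt0 (- (beta * e)).
rewrite invr_gt0 => n0 h.
have -> : expR (- (beta * e)) = 1 - beta * expint beta e by rewrite -h addrK.
have n1 : 1 + (1 - beta * expint beta e) != 0.
  rewrite -[X in _ + (X - _)]h addrK gt_eqF//.
by field; rewrite b0 n1.
Qed.

(** The slope [b] solves [cone beta H b (2 * e) = M], a linear equation in [b]; the value at [e]
    then follows from the two doubling identities. *)
Lemma cone_double beta H M e : 0 < e ->
  let b := (M + H * expint2 beta (2 * e)) / expint beta (2 * e) in
  cone beta H b (2 * e) = M /\
  cone beta H b e = fdp beta e * M + H * fdk beta e.
Proof.
move=> e0 b; have G0 : expint beta (2 * e) != 0.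
  by rewrite gt_eqF// expint_gt0// mulr_gt0.
split; first by rewrite /cone /b divfK// addrK.
rewrite /cone /b -expint2_double -(expint_double beta e).
by field.
Qed.

(* For [H > 0] the cone may decrease before [T]; it is then used only up to its
   maximum, where it is still above its value at [T]. *)
Lemma cone_peak beta H b T : 0 < H -> 0 < b -> 0 < T ->
  exists R0, [/\ 0 < R0 <= T, forall r, 0 < r < R0 -> 0 < dcone beta H b r
    & forall r, R0 <= r <= T -> cone beta H b T <= cone beta H b r].
Proof.
move=> H0 b0 T0.
have pos c r : expint (- beta) r < expint (- beta) c ->
    expint (- beta) c <= b / H -> 0 < dcone beta H b r.
  move=> rc cb; rewrite dconeE mulr_gt0 ?expR_gt0// subr_gt0 mulrC -ltr_pdivlMr//.
  exact: lt_le_trans cb.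
have [le|lt] := leP (expint (- beta) T) (b / H).
  exists T; split; first by rewrite T0 lexx.
    by move=> r /andP[r0 rT]; apply: (pos T) => //; exact: expint_lt.
  by move=> r /andP[r0 rT]; rewrite (le_anti (introT andP (conj r0 rT))).
(* The slope vanishes where [expint (- beta) c = b / H]; this zero is the peak. *)
have [||c + ce] := @IVT R (expint (- beta)) 0 T (b / H) (ltW T0).
- apply: derivable_within_continuous => z _.
  exact: (@ex_derive _ _ _ _ _ _ _ (is_derive_expint (- beta) z)).
- rewrite expint0 ge_min le_max ltW ?divr_gt0//= (ltW lt) orbT.
  by [].
rewrite in_itv/= => /andP[c0 cT].
have cp : 0 < c.
  rewrite lt_neqAle c0 andbT; apply: contraTneq (divr_gt0 b0 H0) => c00.
  by rewrite -ce -c00 expint0 ltxx.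
exists c; split; first by rewrite cp cT.
  by move=> r /andP[r0 rc]; apply: (pos c); rewrite ?ce ?lexx// -ce expint_lt.
move=> r /andP[cr rT].
rewrite -lerN2.
have D (z : R) : is_derive z 1 (- cone beta H b) (- dcone beta H b z).
  exact: is_deriveN (is_derive_cone beta H b z).
apply: (derive_homo_le D rT) => z /andP[rz zT].
rewrite oppr_ge0 dconeE mulr_ge0_le0 ?expR_ge0// subr_le0.
by rewrite mulrC -ler_pdivrMr// -ce ltW// expint_lt// (le_lt_trans cr).
Qed.

End Cone.

(** * Second-order Taylor bounds *)

Section Taylor.
Context {R : realType}.

Lemma is_derive_dist (f : R -> R) (x d e : R) : is_derive x 1 f d -> 0 < e ->
  exists2 r : R, 0 < r &
    forall t, `|t| < r -> `|f (x + t) - f x - d * t| <= e * `|t|.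
Proof.
move=> fd e0.
have c : (fun h : R => h^-1 *: ((f \o shift x) (h *: 1) - f x)) @ 0^' --> d.
  rewrite -(@derive_val _ _ _ _ _ _ _ fd); exact: (@ex_derive _ _ _ _ _ _ _ fd).
have /cvgrPdist_le /(_ e e0) := c.
rewrite /= near_withinE => /nbhs_ballP[r r0 h]; exists r => // t tr.
have [->|t0] := eqVneq t 0; first by rewrite addr0 subrr mulr0 subrr normr0 mulr0.
have := h t; rewrite /ball/= sub0r normrN => /(_ tr t0).
rewrite /GRing.scale/= mulr1 (addrC t) => h1.
rewrite -ler_pdivrMr ?normr_gt0// -normfV -normrM -normrN; congr (_ <= _) : h1.
by congr (`|_|); field.
Qed.

(** The quadratic minus [f] vanishes at [x]; by the first-order expansion of [df] at [x] it
    decreases up to [x] and increases after it. *)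
Lemma taylor2_ub (f df : R -> R) (x d2 e : R) :
  (forall z : R, is_derive z 1 f (df z)) -> is_derive x 1 df d2 -> 0 < e ->
  exists2 r : R, 0 < r & forall t, `|t| < r ->
    f (x + t) <= f x + df x * t + (d2 / 2 + e) * t ^+ 2.
Proof.
move=> fd dfd e0.
(* The error allowed in [df] is [2 * e] times the distance, which matches the derivative of the
   extra term [e * t ^+ 2]. *)
have [r r0 dr] := is_derive_dist dfd (mulr_gt0 (ltr0n R 2) e0).
exists r => // t tr.
pose D z := f x + df x * (z - x) + (d2 / 2 + e) * (z - x) ^+ 2 - f z.
pose dD z := df x + (d2 + 2 * e) * (z - x) - df z.
have DD (z : R) : is_derive z 1 D (dD z).
  have h := fd z.
  have h1 : is_derive z 1 (fun z => z - x) 1.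
    by apply: is_derive_eq; rewrite subr0.
  have -> : D = (cst (f x) + df x \*: (fun z => z - x))
     + (d2 / 2 + e) \*: ((fun z => z - x) ^+ 2) - f by [].
  apply: (is_derive_eq (is_deriveB (is_deriveD (is_deriveD
    (is_derive_cst (f x) z 1) (is_deriveZ (df x) h1))
    (is_deriveZ (d2 / 2 + e) (is_deriveX 2 h1))) h)).
  rewrite /dD /GRing.scale/= expr1 mulr1 add0r; congr (_ - _).
  by congr (_ + _); field.
have [t0|t0] := leP 0 t.
  suff : D x <= D (x + t).
    by rewrite /D (addrC x t) addrK subrr expr0n/= !mulr0 !addr0 subrr subr_ge0.
  apply: (derive_homo_le DD); first by rewrite lerDl.
  move=> z /andP[xz zt].
  have := dr (z - x); rewrite ger0_norm ?subr_ge0 ?(ltW xz)//.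
  rewrite ltrBlDl (lt_trans zt) ?ltrD2l ?(le_lt_trans (ler_norm _) tr)//.
  by move=> /(_ isT); rewrite (addrC x) subrK ler_distl /dD => /andP[_]; lra.
suff : - D (x + t) <= - D x.
  by rewrite lerN2 /D (addrC x t) addrK subrr expr0n/= !mulr0 !addr0 subrr subr_ge0.
apply: (@derive_homo_le _ (- D) (- dD)).
- by rewrite gerDl ltW.
move=> z /andP[xz zt].
have := dr (z - x); rewrite ltr0_norm ?subr_lt0// opprB.
have -> : x - z < r by move: tr; rewrite ltr0_norm//; lra.
move=> /(_ isT); rewrite (addrC x) subrK ler_distl => /andP[+ _].
rewrite -[(- dD) z]/(- dD z) /dD; lra.
Qed.

(* [r0 + t] is turned into [r0 ^+ 2 + s] with [s = 2 r0 t + t ^+ 2]; the cubic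
   and quartic remainders in [t] are absorbed by [e]. *)
Lemma taylor2_sqr (f df : R -> R) (r0 d2 e : R) :
  (forall z : R, is_derive z 1 f (df z)) -> is_derive r0 1 df d2 ->
  0 < e -> 0 < r0 ->
  exists A1 A2 : R, [/\ 2 * (A1 + 2 * A2 * r0 ^+ 2) * r0 = df r0,
    2 * (A1 + 2 * A2 * r0 ^+ 2) + 8 * A2 * r0 ^+ 2 = d2 + 2 * e &
    exists2 d : R, 0 < d & forall r, `|r - r0| < d ->
      f r - f r0 <= (A1 * r ^+ 2 + A2 * (r ^+ 2) ^+ 2)
                    - (A1 * r0 ^+ 2 + A2 * (r0 ^+ 2) ^+ 2)].
Proof.
move=> fd dfd e0 rp.
have e20 : 0 < e / 2 by rewrite divr_gt0.
have [d d0 tl] := taylor2_ub fd dfd e20.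
(* The quartic [A1 * r ^+ 2 + A2 * (r ^+ 2) ^+ 2] gets slope [df r0] and second derivative
   [d2 + 2 * e] at [r0]; [A] is its derivative with respect to [r ^+ 2]. *)
pose A := df r0 / (2 * r0).
pose A2 := (d2 / 2 + e - A) / (4 * r0 ^+ 2).
pose A1 := A - 2 * A2 * r0 ^+ 2.
have n0 : r0 != 0 by rewrite gt_eqF.
have eA : A1 + 2 * A2 * r0 ^+ 2 = A by rewrite /A1 subrK.
exists A1, A2; rewrite eA; split.
- by rewrite /A; field.
- by rewrite /A2; field.
(* [C] bounds [4 * A2 * r0 + A2 * t] for [|t| <= 1], so the terms of order three and four stay below
   [e / 2 * t ^+ 2] once [|t| <= e / 2 / C]. *)
pose C := 4 * `|A2| * r0 + `|A2| + 1.
have C0 : 0 < C by rewrite /C ltr_wpDl// addr_ge0// mulr_ge0 ?mulr_ge0// ltW.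
exists (Num.min d (Num.min 1 (e / 2 / C))).
  by rewrite !lt_min d0 ltr01 divr_gt0.
move=> r; rewrite !lt_min => /and3P[rd r1 rC].
set t := r - r0 in rd r1 rC.
have -> : r = r0 + t by rewrite /t addrC subrK.
have := tl t rd; set L := f _ => h.
have e1 : A1 * (r0 + t) ^+ 2 + A2 * ((r0 + t) ^+ 2) ^+ 2
          - (A1 * r0 ^+ 2 + A2 * (r0 ^+ 2) ^+ 2)
  = df r0 * t + (d2 / 2 + e) * t ^+ 2 + t ^+ 2 * (t * (4 * A2 * r0 + A2 * t)).
  by rewrite /A1 /A2 /A; field.
rewrite e1.
suff : - (e / 2) * t ^+ 2 <= t ^+ 2 * (t * (4 * A2 * r0 + A2 * t)) by move: h; lra.
rewrite mulrC ler_wpM2l ?sqr_ge0// lerNl.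
apply: (le_trans (ler_norm _)); rewrite normrN normrM.
have b : `|4 * A2 * r0 + A2 * t| <= C.
  apply: (le_trans (ler_normD _ _)).
  rewrite (normrM A2 t) (normrM _ r0) (normrM 4 A2) (gtr0_norm rp) (ger0_norm (ler0n R 4)).
  have : `|A2| * `|t| <= `|A2| by rewrite ler_piMr// ltW.
  by rewrite /C; lra.
apply: (le_trans (ler_wpM2l (normr_ge0 t) b)).
by rewrite -ler_pdivlMr// ltW.
Qed.

End Taylor.

(** * The Euclidean norm and radial test functions *)

Section Euclid.
Context {R : realType} {n : nat}.
Local Notation V := 'rV[R]_n.
Implicit Types x y z v : V.

Lemma dotpC x y : dotp x y = dotp y x.
Proof. by apply: eq_bigr => i _; rewrite mulrC. Qed.

Lemma dotpDl x y z : dotp (x + y) z = dotp x z + dotp y z.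
Proof. by rewrite /dotp -big_split; apply: eq_bigr => i _; rewrite mxE mulrDl. Qed.

Lemma dotpZl a x z : dotp (a *: x) z = a * dotp x z.
Proof. by rewrite /dotp mulr_sumr; apply: eq_bigr => i _; rewrite mxE mulrA. Qed.

Lemma dotpNl x z : dotp (- x) z = - dotp x z.
Proof. by rewrite -scaleN1r dotpZl mulN1r. Qed.

Lemma dotpDr x y z : dotp x (y + z) = dotp x y + dotp x z.
Proof. by rewrite dotpC dotpDl !(dotpC x). Qed.

Lemma dotpZr a x z : dotp x (a *: z) = a * dotp x z.
Proof. by rewrite dotpC dotpZl dotpC. Qed.

Lemma dotpNr x z : dotp x (- z) = - dotp x z.
Proof. by rewrite dotpC dotpNl dotpC. Qed.

Lemma dotpx0 x : dotp x 0 = 0.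
Proof. by rewrite -(scale0r 0) dotpZr mul0r. Qed.

Lemma dotp_ge0 x : 0 <= dotp x x.
Proof. by apply: sumr_ge0 => i _; rewrite -expr2 sqr_ge0. Qed.

Lemma dotp_eq0 x : (dotp x x == 0) = (x == 0).
Proof.
apply/idP/eqP => [|->]; last by rewrite /dotp big1// => i _; rewrite mxE mul0r.
rewrite psumr_eq0 => [/allP h|i _]; last by rewrite -expr2 sqr_ge0.
apply/rowP => i; rewrite mxE; have := h i (mem_index_enum i).
by rewrite /= mulf_eq0 orbb => /eqP.
Qed.

Lemma dotp_gt0 x : (0 < dotp x x) = (x != 0).
Proof. by rewrite lt_neqAle dotp_ge0 andbT eq_sym dotp_eq0. Qed.

Lemma enorm_ge0 x : 0 <= enorm x.
Proof. exact: sqrtr_ge0. Qed.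

Lemma sqr_enorm x : enorm x ^+ 2 = dotp x x.
Proof. by rewrite sqr_sqrtr// dotp_ge0. Qed.

Lemma enorm_eq0 x : (enorm x == 0) = (x == 0).
Proof. by rewrite -dotp_eq0 -sqr_enorm sqrf_eq0. Qed.

Lemma enorm_gt0 x : (0 < enorm x) = (x != 0).
Proof. by rewrite lt_neqAle enorm_ge0 andbT eq_sym enorm_eq0. Qed.

Lemma enorm0 : enorm (0 : V) = 0.
Proof. by apply/eqP; rewrite enorm_eq0. Qed.

Lemma enormZ a x : enorm (a *: x) = `|a| * enorm x.
Proof.
rewrite /enorm dotpZl dotpZr mulrA -expr2 sqrtrM ?sqr_ge0//.
by rewrite sqrtr_sqr.
Qed.

Lemma enormN x : enorm (- x) = enorm x.
Proof. by rewrite -scaleN1r enormZ normrN1 mul1r. Qed.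

Lemma enormB x y : enorm (x - y) = enorm (y - x).
Proof. by rewrite -enormN opprB. Qed.

(** Cauchy-Schwarz, from the nonnegative squared length of [dotp y y *: x - dotp x y *: y]. *)
Lemma dotp_le_enorm x y : dotp x y <= enorm x * enorm y.
Proof.
apply: (le_trans (ler_norm _)).
rewrite -(@ler_pXn2r _ 2)// ?nnegrE ?mulr_ge0 ?enorm_ge0//.
rewrite real_normK ?num_real// exprMn !sqr_enorm.
have [->|y0] := eqVneq y 0.
  by rewrite !dotpx0 expr0n mulr0.
have := dotp_ge0 (dotp y y *: x - dotp x y *: y).
rewrite !(dotpDl, dotpDr, dotpNl, dotpNr, dotpZl, dotpZr) (dotpC y x).
have y1 : 0 < dotp y y by rewrite dotp_gt0.
set a := dotp y y in y1 *; set b := dotp x y; set c := dotp x x => h.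
rewrite -(ler_pM2l y1) -subr_ge0; congr (_ <= _) : h; ring.
Qed.

Lemma enormD x y : enorm (x + y) <= enorm x + enorm y.
Proof.
rewrite -(@ler_pXn2r _ 2)// ?nnegrE ?addr_ge0 ?enorm_ge0//.
rewrite sqrrD !sqr_enorm !dotpDl !dotpDr (dotpC y x).
have := dotp_le_enorm x y; lra.
Qed.

Lemma enorm_triangle x y z : enorm (x - z) <= enorm (x - y) + enorm (y - z).
Proof. by apply: le_trans (enormD _ _); rewrite subrKA. Qed.

Lemma coord_le_norm x i : `|x 0 i| <= `|x|.
Proof.
by rewrite [leRHS]/Num.norm/= mx_normrE; exact: (le_bigmax _ (fun ij => `|x ij.1 ij.2|) (0, i)).
Qed.

Lemma norm_le_enorm x : `|x| <= enorm x.
Proof.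
rewrite [leLHS]/Num.norm/= mx_normrE; apply: bigmax_le; first exact: enorm_ge0.
move=> [i j] _; rewrite (ord1 i)/=.
rewrite -(@ler_pXn2r _ 2)// ?nnegrE ?enorm_ge0// sqr_enorm real_normK ?num_real//.
by rewrite /dotp (bigD1 j)//= -expr2 lerDl sumr_ge0// => k _; rewrite -expr2 sqr_ge0.
Qed.

(** The norm on the right is the maximum norm. The factor [n.+1] is positive in every dimension, so
    radii can be divided by it. *)
Lemma enorm_le_norm x : enorm x <= n.+1%:R * `|x|.
Proof.
rewrite -(@ler_pXn2r _ 2)// ?nnegrE ?enorm_ge0// ?mulr_ge0// sqr_enorm.
apply: (@le_trans _ _ (\sum_(i < n) `|x| ^+ 2)).
  apply: ler_sum => i _; rewrite -expr2 -(@real_normK _ (x 0 i)) ?num_real//.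
  by rewrite ler_pXn2r ?nnegrE// coord_le_norm.
rewrite sumr_const card_ord exprMn -[leLHS]mulr_natl ler_wpM2r ?sqr_ge0//.
by rewrite -natrX ler_nat expnS expn1 (leq_trans (leqnSn n))// leq_pmulr.
Qed.

Lemma nbhs_enormP x (P : set V) :
  nbhs x P <-> exists2 d : R, 0 < d & forall y, enorm (y - x) < d -> P y.
Proof.
split.
  move=> /nbhs_ballP[d d0 h]; exists d => // y yd; apply: h.
  rewrite -ball_normE/=; apply: (le_lt_trans (norm_le_enorm _)).
  by rewrite enormB.
move=> [d d0 h]; apply/nbhs_ballP; exists (d / n.+1%:R); first exact: divr_gt0.
move=> y; rewrite -ball_normE/= => yd; apply: h.
rewrite enormB; apply: (le_lt_trans (enorm_le_norm _)).
by rewrite mulrC -ltr_pdivlMr.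
Qed.

Lemma closure_enorm (O : set V) x (d : R) : closure O x -> 0 < d ->
  exists2 y, O y & enorm (y - x) < d.
Proof.
move=> cx d0.
have /cx[y [Oy yd]] : nbhs x [set y | enorm (y - x) < d].
  by apply/nbhs_enormP; exists d.
by exists y.
Qed.

Lemma open_enorm (O : set V) x : open O -> O x ->
  exists2 d : R, 0 < d & forall y, enorm (y - x) < d -> O y.
Proof. by move=> oO Ox; apply/nbhs_enormP; exact: open_nbhs_nbhs. Qed.

Lemma usc_enorm (S : set V) (f : V -> R) x (e : R) : usc_on S f -> S x -> 0 < e ->
  exists2 d : R, 0 < d & forall y, S y -> enorm (y - x) < d -> f y < f x + e.
Proof.
move=> uf Sx e0; have [d d0 h] := uf x Sx e e0; exists d => // y Sy yd.
by apply: h => //; exact: le_lt_trans (norm_le_enorm _) yd.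
Qed.

Lemma ler_dist_enorm x y : `|enorm x - enorm y| <= enorm (x - y).
Proof.
rewrite ler_distl; apply/andP; split.
  by rewrite lerBlDr enormB -{1}(subrK x y) (le_trans (enormD _ _))// addrC.
by rewrite -lerBlDl lerBlDr -{1}(subrK y x) enormD.
Qed.

Lemma continuous_enormB x : continuous (fun y => enorm (y - x)).
Proof.
move=> y; apply/(@cvgrPdist_lt _ _ _ _ (nbhs_filter y)) => e e0.
apply/nbhs_enormP; exists e => // z ze.
apply: (le_lt_trans (ler_dist_enorm _ _)).
by rewrite opprB addrA subrK enormB.
Qed.

Lemma is_derive_coord x v i : is_derive x v (fun y : V => y 0 i) (v 0 i).
Proof.
have h : (fun h => h^-1 *: (((fun y : V => y 0 i) \o shift x) (h *: v) - x 0 i)) @ 0^'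
     --> v 0 i.
  apply: cvg_near_cst.
  near=> h; rewrite /= !mxE addrK /GRing.scale/= mulKf//; near: h; exact: nbhs_dnbhs_neq.
apply: DeriveDef; first by apply/cvg_ex; exists (v 0 i).
exact: cvg_lim h.
Unshelve. all: by end_near. Qed.

Lemma is_derive_coordB c x v i : is_derive x v (fun y : V => (y - c) 0 i) (v 0 i).
Proof.
have -> : (fun y : V => (y - c) 0 i) = (fun y : V => y 0 i) - cst (c 0 i).
  by apply/funext => y; rewrite /= !mxE.
have := is_deriveB (is_derive_coord x v i) (is_derive_cst (c 0 i) x v).
by rewrite subr0.
Qed.

Definition sqdist (c y : V) : R := dotp (y - c) (y - c).

Lemma is_derive_sqdist c x v :
  is_derive x v (sqdist c) (2 * dotp (x - c) v).
Proof.
have h := is_derive_coordB c x v.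
have -> : sqdist c = \sum_(i < n) (fun y : V => (y - c) 0 i) ^+ 2.
  by apply/funext => y; rewrite /sqdist /dotp fct_sumE; apply: eq_bigr => i _.
apply: (is_derive_eq (is_derive_sum (fun i => is_deriveX 2 (h i)))).
rewrite /dotp mulr_sumr; apply: eq_bigr => i _.
by rewrite /GRing.scale/= expr1 mulrA.
Qed.

(** A polynomial in the squared distance is smooth at the centre as well, so it is a global [C2]
    test function; two coefficients are enough to prescribe the first and second radial derivatives
    at one radius. *)
Definition radial (A1 A2 : R) (c y : V) : R :=
  A1 * sqdist c y + A2 * sqdist c y ^+ 2.

Lemma is_derive_radial A1 A2 c x v : is_derive x v (radial A1 A2 c)
  (2 * (A1 + 2 * A2 * sqdist c x) * dotp (x - c) v).
Proof.
have h := is_derive_sqdist c x v.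
have -> : radial A1 A2 c = A1 \*: sqdist c + A2 \*: (sqdist c) ^+ 2 by [].
apply: (is_derive_eq (is_deriveD (is_deriveZ A1 h) (is_deriveZ A2 (is_deriveX 2 h)))).
by rewrite /GRing.scale/= expr1; ring.
Qed.

Lemma dotp_evec x i : dotp x (evec i) = x 0 i.
Proof.
rewrite /dotp (bigD1 i)//= big1 ?addr0; last first.
  by move=> j ji; rewrite mxE eqxx/= (negbTE ji) mulr0.
by rewrite mxE !eqxx mulr1.
Qed.

Lemma pderiv_radial A1 A2 c i : pderiv i (radial A1 A2 c) =
  (fun x => 2 * (A1 + 2 * A2 * sqdist c x) * (x - c) 0 i).
Proof.
apply/funext => x; rewrite -dotp_evec.
exact: (@derive_val _ _ _ _ _ _ _ (is_derive_radial A1 A2 c x (evec i))).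
Qed.

Lemma is_derive_pderiv_radial A1 A2 c i x v :
  is_derive x v (pderiv i (radial A1 A2 c))
   (2 * (A1 + 2 * A2 * sqdist c x) * v 0 i + 8 * A2 * (x - c) 0 i * dotp (x - c) v).
Proof.
rewrite pderiv_radial.
have h := is_derive_sqdist c x v.
have h1 := is_derive_coordB c x v i.
have -> : (fun x => 2 * (A1 + 2 * A2 * sqdist c x) * (x - c) 0 i) =
  ((cst (2 * A1) + (4 * A2) \*: sqdist c) * (fun y : V => (y - c) 0 i)).
  apply/funext => y.
  have -> : ((cst (2 * A1) + (4 * A2) \*: sqdist c) * (fun y : V => (y - c) 0 i)) y
    = (2 * A1 + (4 * A2) * sqdist c y) * (y - c) 0 i by [].
  by ring.
apply: (is_derive_eq (is_deriveM (is_deriveD (is_derive_cst (2 * A1) x v)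
  (is_deriveZ (4 * A2) h)) h1)).
have -> : (cst (2 * A1) + (4 * A2) \*: sqdist c) x = 2 * A1 + 4 * A2 * sqdist c x by [].
by rewrite add0r /GRing.scale/=; ring.
Qed.

Lemma continuous_sqdist c : continuous (sqdist c).
Proof.
have -> : sqdist c = (fun y => enorm (y - c) ^+ 2).
  by apply/funext => y; rewrite sqr_enorm.
move=> y; apply: (@continuous_comp _ _ _ (fun y => enorm (y - c)) (fun r => r ^+ 2)).
  exact: continuous_enormB.
exact: exprn_continuous.
Qed.


Lemma continuous_coordB c i : continuous (fun y : V => (y - c) 0 i).
Proof.
have -> : (fun y : V => (y - c) 0 i) = (fun y : V => y 0 i - c 0 i).
  by apply/funext => y; rewrite !mxE.
by move=> y; apply: continuousB; [exact: coord_continuous | exact: cst_continuous].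
Qed.

Lemma pderiv2_radial A1 A2 c i j : pderiv j (pderiv i (radial A1 A2 c)) =
  (fun x => 2 * (A1 + 2 * A2 * sqdist c x) * (i == j)%:R
            + 8 * A2 * (x - c) 0 i * (x - c) 0 j).
Proof.
apply/funext => x.
have h := is_derive_pderiv_radial A1 A2 c i x (evec j).
have := @derive_val _ _ _ _ _ _ _ h; rewrite dotp_evec mxE/= => e.
exact: e.
Qed.

Let continuous_forall (f : V -> R) :
  (forall y : V, {for y, continuous f}) -> continuous f.
Proof. by []. Qed.

Lemma C2_radial A1 A2 c : C2 (radial A1 A2 c).
Proof.
have cs := @continuous_sqdist c.
split.
  apply: continuous_forall => y; apply: continuousD; apply: continuousM.
  - exact: cst_continuous.
  - exact: cs.
  - exact: cst_continuous.
  - apply: (@continuous_comp _ _ _ (sqdist c) (fun r => r ^+ 2)); first exact: cs.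
    exact: exprn_continuous.
have ca (y : V) : {for y, continuous (fun x => 2 * (A1 + 2 * A2 * sqdist c x))}.
  apply: continuousM; first exact: cst_continuous.
  apply: continuousD; first exact: cst_continuous.
  apply: continuousM; first exact: cst_continuous.
  exact: cs.
split; first by move=> i x; exact: (@ex_derive _ _ _ _ _ _ _ (is_derive_radial A1 A2 c x (evec i))).
split.
  move=> i; rewrite pderiv_radial; apply: continuous_forall => y.
  by apply: continuousM; [exact: ca | exact: continuous_coordB].
split.
  move=> i j x.
  exact: (@ex_derive _ _ _ _ _ _ _ (is_derive_pderiv_radial A1 A2 c i x (evec j))).
move=> i j; rewrite pderiv2_radial; apply: continuous_forall => y.
apply: continuousD; apply: continuousM.
- exact: ca.
- exact: cst_continuous.
- by apply: continuousM; [exact: cst_continuous | exact: continuous_coordB].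
- exact: continuous_coordB.
Qed.

Lemma grad_radial A1 A2 c x :
  grad (radial A1 A2 c) x = (2 * (A1 + 2 * A2 * sqdist c x)) *: (x - c).
Proof. by apply/rowP => i; rewrite mxE pderiv_radial !mxE. Qed.

Lemma quadf_hess_radial A1 A2 c x v : quadf (hess (radial A1 A2 c) x) v =
  2 * (A1 + 2 * A2 * sqdist c x) * dotp v v + 8 * A2 * dotp (x - c) v ^+ 2.
Proof.
set a := 2 * (A1 + 2 * A2 * sqdist c x).
have E i : \sum_(j < n) hess (radial A1 A2 c) x i j * v 0 j * v 0 i
   = a * (v 0 i * v 0 i) + 8 * A2 * dotp (x - c) v * ((x - c) 0 i * v 0 i).
  transitivity (\sum_(j < n) (a * (v 0 i) * ((i == j)%:R * v 0 j)
     + 8 * A2 * ((x - c) 0 i * v 0 i) * ((x - c) 0 j * v 0 j))).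
    by apply: eq_bigr => j _; rewrite [hess _ _]/hess mxE pderiv2_radial -/a; ring.
  rewrite big_split/= -!mulr_sumr (bigD1 i)//= eqxx mul1r big1 ?addr0.
    by rewrite /dotp; ring.
  by move=> j ji; rewrite eq_sym (negbTE ji) mul0r.
rewrite /quadf (eq_bigr _ (fun i _ => E i)) big_split/= -!mulr_sumr.
by rewrite -[\sum_(i < n) v 0 i * v 0 i]/(dotp v v) -[\sum_(i < n) _]/(dotp (x - c) v); ring.
Qed.

(** The gradient is parallel to [x - c], an eigenvector of the Hessian, so the value is the second
    derivative in the radial direction. *)
Lemma inf_lap_plus_radial A1 A2 c x :
  (2 * (A1 + 2 * A2 * sqdist c x)) *: (x - c) != 0 ->
  inf_lap_plus (radial A1 A2 c) x =
    2 * (A1 + 2 * A2 * sqdist c x) + 8 * A2 * sqdist c x.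
Proof.
move=> h; rewrite /inf_lap_plus grad_radial h quadf_hess_radial sqr_enorm.
set a := 2 * _ in h *; move: h; rewrite scaler_eq0 negb_or => /andP[a0 xc].
rewrite !(dotpZl, dotpZr) -/(sqdist c x).
have s0 : sqdist c x != 0 by rewrite gt_eqF// dotp_gt0.
by field; rewrite a0 s0.
Qed.

(** The Hessian is [2 * A] times the identity, so the supremum at a critical point gives the same
    value as the quotient elsewhere; [0 < n] provides a unit vector. *)
Lemma inf_lap_plus_sqdist A c x : (0 < n)%N ->
  inf_lap_plus (radial A 0 c) x = 2 * A.
Proof.
move=> n0; have [g0|g0] := eqVneq (grad (radial A 0 c) x) 0; last first.
  rewrite inf_lap_plus_radial; last by rewrite -grad_radial.
  by ring.
rewrite /inf_lap_plus g0 eqxx/=.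
have -> : [set quadf (hess (radial A 0 c) x) v | v in [set v : V | enorm v = 1]]
  = [set 2 * A].
  apply/seteqP; split=> [_ [v v1 <-]|_ ->]/=.
    by rewrite quadf_hess_radial -sqr_enorm v1; ring.
  pose i := Ordinal n0.
  have e1 : dotp (evec i) (evec i) = 1 :> R by rewrite dotp_evec mxE !eqxx.
  exists (evec i); first by rewrite /= /enorm e1 sqrtr1.
  by rewrite quadf_hess_radial e1; ring.
by rewrite sup1.
Qed.

End Euclid.

(* The superlevel sets of [f] in [C] generate a proper filter; any cluster point
   of it is a maximum point. *)
Lemma compact_usc_max {R : realType} (T : topologicalType) (C : set T) (f : T -> R) :
  compact C -> C !=set0 ->
  (forall x, C x -> forall c, f x < c -> \forall y \near x, C y -> f y < c) ->
  exists2 x, C x & forall y, C y -> f y <= f x.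
Proof.
move=> cC [x0 Cx0] uf.
pose B y := [set x | C x /\ f y <= f x].
pose F := filter_from C B.
have FF : ProperFilter F.
  apply: filter_from_proper; last by move=> y Cy; exists y.
  apply: filter_from_filter; first by exists x0.
  move=> y z Cy Cz; have [yz|zy] := leP (f y) (f z).
    by exists z => // x [Cx zx]; split; split=> //; exact: le_trans zx.
  by exists y => // x [Cx yx]; split; split=> //; apply: le_trans yx; exact: ltW.
have FC : F C by exists x0 => // x [].
have [x [Cx clx]] := cC F FF FC.
exists x => // y Cy; rewrite leNgt; apply/negP => xy.
have := clx (B y) [set z | C z -> f z < f y]; case.
- by exists y.
- exact: uf.
by move=> z [[Cz yz] /(_ Cz)]; rewrite ltNge yz.
Qed.

(** * Compact sets, Euclidean balls and semicontinuity *)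

Section Ball.
Context {R : realType} {n : nat}.
Local Notation V := 'rV[R]_n.
Implicit Types (O A S : set V) (c w x y : V).

Lemma bounded_compact_closure O : bounded_setV O -> compact (closure O).
Proof.
move=> [M OM]; apply: bounded_closed_compact; last exact: closed_closure.
exists M; split; first exact: num_real.
move=> N MN x clx; rewrite /=; apply/ler_addgt0Pr => e e0.
have [y Oy yx] := closure_enorm clx e0.
rewrite -(subrK y x) addrC; apply: (le_trans (ler_normD _ _)); apply: lerD.
  exact: le_trans (OM _ Oy) (ltW MN).
by rewrite distrC; apply: ltW; exact: le_lt_trans (norm_le_enorm _) yx.
Qed.

Lemma closed_enorm_ball c (r : R) : closed [set y : V | enorm (y - c) <= r].
Proof.
apply/closure_id/seteqP; split; first exact: subset_closure.
move=> x clx; apply/ler_addgt0Pr => e e0.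
have [y /= yr yx] := closure_enorm clx e0.
by rewrite (le_trans (enorm_triangle _ y _))// addrC lerD// enormB ltW.
Qed.

Lemma usc_onP S (f : V -> R) x (c : R) : usc_on S f -> S x -> f x < c ->
  \forall y \near x, S y -> f y < c.
Proof.
move=> uf Sx fc; have e0 : 0 < c - f x by rewrite subr_gt0.
have [d d0 h] := usc_enorm uf Sx e0.
by apply/nbhs_enormP; exists d => // y yd Sy; have := h y Sy yd; rewrite addrC subrK.
Qed.

Lemma usc_on_max S C (f : V -> R) : usc_on S f -> C `<=` S -> compact C -> C !=set0 ->
  exists2 x, C x & forall y, C y -> f y <= f x.
Proof.
move=> uf CS cC C0; apply: compact_usc_max => // x Cx c fc.
by apply: filterS (usc_onP uf (CS _ Cx) fc) => y h /CS.
Qed.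

Lemma usc_onB S (f : V -> R) (g : V -> R) : usc_on S f -> continuous g ->
  usc_on S (fun y => f y - g y).
Proof.
move=> uf cg x Sx e e0; have e2 : 0 < e / 2 by rewrite divr_gt0.
have [d d0 h] := uf x Sx _ e2.
have /nbhs_enormP[d' d'0 h'] : \forall y \near x, `|g x - g y| < e / 2.
  by have /(@cvgrPdist_lt _ _ _ _ (nbhs_filter x)) := cg x; exact.
exists (Num.min d (d' / n.+1%:R)); first by rewrite lt_min d0 divr_gt0.
move=> y Sy; rewrite lt_min => /andP[yd yd'].
have := h y Sy yd; have := h' y; rewrite ltr_distl => h2.
have /h2/andP[_] : enorm (y - x) < d'.
  by apply: (le_lt_trans (enorm_le_norm _)); rewrite mulrC -ltr_pdivlMr.
lra.
Qed.

Lemma loc_max_rel_enorm S (f : V -> R) x (d : R) : 0 < d ->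
  (forall y, S y -> enorm (y - x) < d -> f y <= f x) -> loc_max_rel S f x.
Proof.
move=> d0 h; exists (d / n.+1%:R); first by rewrite divr_gt0.
move=> y Sy yd; apply: h => //.
by apply: (le_lt_trans (enorm_le_norm _)); rewrite mulrC -ltr_pdivlMr.
Qed.

Lemma continuous_cone_enorm beta H b c :
  continuous (fun y : V => cone beta H b (enorm (y - c))).
Proof.
move=> y; apply: (@continuous_comp _ _ _ (fun y => enorm (y - c)) (cone beta H b)).
  exact: continuous_enormB.
apply: differentiable_continuous; apply/derivable1_diffP.
exact: (@ex_derive _ _ _ _ _ _ _ (is_derive_cone beta H b _)).
Qed.

Lemma cone_near beta H b (r e : R) : 0 < e -> exists2 d : R, 0 < d &
  forall s, `|s - r| < d -> `|cone beta H b s - cone beta H b r| < e.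
Proof.
move=> e0; have c : {for r, continuous (cone beta H b)}.
  apply: differentiable_continuous; apply/derivable1_diffP.
  exact: (@ex_derive _ _ _ _ _ _ _ (is_derive_cone beta H b _)).
have /cvgrPdist_lt/(_ e e0)/nbhs_ballP[d d0 h] := c.
by exists d => // s sd; rewrite distrC; apply: h; rewrite /ball/= distrC.
Qed.

End Ball.

(** * Comparison of a subsolution with cones *)

Section ConeComparison.
Context {R : realType} {n : nat}.
Local Notation V := 'rV[R]_n.
Variables (O A : set V) (nu : V -> V) (beta : R) (h u : V -> R).
Hypothesis oO : open O.
Hypothesis bO : bounded_setV O.
Hypothesis nuO : forall c w, O c -> GammaN O A w -> 0 < dotp (w - c) (nu w).
Hypothesis su : subsolution O A nu beta h u.
Implicit Types (c w x y : V) (H b : R).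

(** The cone is replaced near [w] by a radial polynomial touching it from above. Its gradient is a
    positive multiple of [w - c], so [nuO] rules out the boundary alternative and the equation must
    hold. *)
Lemma cone_no_touch c w H b : O c -> (O `|` GammaN O A) w -> w != c -> h w < H ->
  0 < dcone beta H b (enorm (w - c)) ->
  ~ loc_max_rel (closure O) (fun y => u y - cone beta H b (enorm (y - c))) w.
Proof.
move=> Oc Ow wc hH dc [d d0 mx].
set r0 := enorm (w - c) in dc.
have r0p : 0 < r0 by rewrite enorm_gt0 subr_eq0.
(* On the test function the operator equals [H - 2 * e], which is still above [h w]. *)
pose e := (H - h w) / 4.
have e0 : 0 < e by rewrite divr_gt0// subr_gt0.
have [A1 [A2 [g1 g2 [d' d'0 tl]]]] :=
  taylor2_sqr (is_derive_cone beta H b) (is_derive_dcone beta H b r0) e0 r0p.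
have sq y : sqdist c y = enorm (y - c) ^+ 2 by rewrite sqr_enorm.
have lm : loc_max_rel (closure O) (fun y => u y - radial A1 A2 c y) w.
  exists (Num.min d (d' / n.+1%:R)); first by rewrite lt_min d0 divr_gt0.
  move=> y Ky; rewrite lt_min => /andP[yd yd'].
  have := mx y Ky yd; have := tl (enorm (y - c)); rewrite /radial !sq -/r0.
  have -> : `|enorm (y - c) - r0| < d'.
    apply: (le_lt_trans (ler_dist_enorm _ _)); rewrite opprB addrA subrK.
    by apply: (le_lt_trans (enorm_le_norm _)); rewrite mulrC -ltr_pdivlMr.
  have alg (a1 a2 p q b1 b2 : R) : a1 - a2 <= p - q -> b1 - a1 <= b2 - a2 -> b1 - p <= b2 - q.
    by clear -oO bO nuO su; move=> *; lra.
  by move=> /(_ isT); exact: alg.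
set k := 2 * _ in g1 g2.
have k0 : 0 < k by rewrite -(pmulr_lgt0 _ r0p) g1.
have := su.2 _ (C2_radial A1 A2 c) _ Ow lm.
rewrite grad_radial sq -/r0 -/k => -[|[Nw]]; last first.
  rewrite dotpZl pmulr_rle0// => /(lt_le_trans (nuO Oc Nw)).
  by rewrite ltxx.
rewrite inf_lap_plus_radial; rewrite sq -/r0 -/k; last first.
  by rewrite scaler_eq0 subr_eq0 negb_or gt_eqF.
rewrite enormZ gtr0_norm// -/r0 g1 g2 /e.
by clear -oO bO nuO su hH; lra.
Qed.

(** With slope [0] the cone is tangent to a constant at its vertex and lies below a multiple of the
    squared distance there. The gradient vanishes, and minus the infinity Laplacian is [H - 2 * e],
    above [h c]. *)
Lemma cone_no_touch_vertex c H : (0 < n)%N -> O c -> h c < H ->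
  ~ loc_max_rel (closure O) (fun y => u y - cone beta H 0 (enorm (y - c))) c.
Proof.
move=> n0 Oc hH [d d0 mx].
pose e := (H - h c) / 4.
have e0 : 0 < e by rewrite divr_gt0// subr_gt0.
have [d' d'0 tl] :=
  taylor2_ub (is_derive_cone beta H 0) (is_derive_dcone beta H 0 0) e0.
have c0 := cone0 beta H 0.
have dc0 : dcone beta H 0 0 = 0 by rewrite /dcone expint0; ring.
pose B := - H / 2 + e.
have sq y : sqdist c y = enorm (y - c) ^+ 2 by rewrite sqr_enorm.
have lm : loc_max_rel (closure O) (fun y => u y - radial B 0 c y) c.
  exists (Num.min d (d' / n.+1%:R)); first by rewrite lt_min d0 divr_gt0.
  move=> y Ky; rewrite lt_min => /andP[yd yd'].
  have := mx y Ky yd; have := tl (enorm (y - c)).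
  rewrite /radial !sq subrr enorm0 c0 dc0 ger0_norm ?enorm_ge0// expr0n/=.
  have -> : enorm (y - c) < d'.
    by apply: (le_lt_trans (enorm_le_norm _)); rewrite mulrC -ltr_pdivlMr.
  by move=> /(_ isT); rewrite /B add0r; lra.
have [|[[[_ +] _] _]] := su.2 _ (C2_radial B 0 c) _ (or_introl Oc) lm; last first.
  by apply; exact: open_nbhs_nbhs.
rewrite inf_lap_plus_sqdist// grad_radial subrr scaler0 enorm0 /B /e.
by clear -oO bO nuO su hH; lra.
Qed.

(** A maximum point over the closed ball exists; [cone_no_touch] excludes the points between vertex
    and sphere, and [cone_no_touch_vertex] excludes the vertex when [b = 0]. *)
Lemma cone_ball_max c (r : R) H b : O c -> 0 < r ->
  (forall w, closure O w -> enorm (w - c) < r -> (O `|` GammaN O A) w /\ h w < H) ->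
  (forall s, 0 < s < r -> 0 < dcone beta H b s) ->
  exists w0, [/\ closure O w0, w0 = c \/ enorm (w0 - c) = r,
    (b = 0 -> (0 < n)%N -> enorm (w0 - c) = r) &
    forall w, closure O w -> enorm (w - c) <= r ->
      u w - cone beta H b (enorm (w - c)) <= u w0 - cone beta H b (enorm (w0 - c))].
Proof.
move=> Oc r0 reg dc.
pose C := closure O `&` [set y : V | enorm (y - c) <= r].
have cC : compact C.
  by apply: compact_closedI; [exact: bounded_compact_closure|exact: closed_enorm_ball].
have Cc : C c.
  by split; [exact: subset_closure | rewrite /= subrr enorm0 ltW].
have ug := usc_onB su.1 (@continuous_cone_enorm R n beta H b c).
have [w0 [Kw0 /= w0r] mx] := usc_on_max ug (@subIsetl _ _ _) cC (ex_intro _ c Cc).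
have lm : enorm (w0 - c) < r ->
    loc_max_rel (closure O) (fun y => u y - cone beta H b (enorm (y - c))) w0.
  move=> lt; apply: (@loc_max_rel_enorm _ _ _ _ _ (r - enorm (w0 - c))).
    by rewrite subr_gt0.
  move=> y Ky yd; apply: mx; split=> //=.
  by apply: (le_trans (enorm_triangle _ w0 _)); move: yd; lra.
have w0c : w0 = c \/ enorm (w0 - c) = r.
  have [->|nc] := eqVneq w0 c; [by left|right].
  apply/eqP; rewrite eq_le w0r/= leNgt; apply/negP => lt.
  have [Ow hw] := reg _ Kw0 lt.
  apply: (cone_no_touch Oc Ow nc hw _ (lm lt)).
  by apply: dc; rewrite lt andbT enorm_gt0 subr_eq0.
exists w0; split; [exact: Kw0 | exact: w0c | | by move=> w Kw wr; exact: mx].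
move=> b0 n0; case: w0c => // w0c; exfalso.
have lt : enorm (w0 - c) < r by rewrite w0c subrr enorm0.
have [_ hc] := reg _ Kw0 lt.
have hc0 : h c < H by rewrite -w0c.
by apply: (cone_no_touch_vertex n0 Oc hc0); move: (lm lt); rewrite w0c b0.
Qed.

Section Center.
Variables (x : V) (H m r : R).
Hypothesis Kx : closure O x.
Hypothesis r0 : 0 < r.
Hypothesis reg : forall w, closure O w -> enorm (w - x) < r ->
  (O `|` GammaN O A) w /\ h w < H.
Hypothesis um : forall w, closure O w -> enorm (w - x) <= r -> u w <= m.

(* The cone is centred at a nearby point of [O] because a cone centred at a
   point of [GammaN] may be tangent to the boundary. *)
Lemma cone_bound b w : (forall s, 0 < s < r -> 0 < dcone beta H b s) ->
  m - u x <= cone beta H b r ->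
  closure O w -> enorm (w - x) < r -> u w <= u x + cone beta H b (enorm (w - x)).
Proof.
move=> dc mc Kw wr; rewrite leNgt; apply/negP => lt.
(* Moving the vertex from [x] to [c] causes errors below [e]; at most two of them add up in either
   case, less than the excess [3 * e]. *)
pose e := (u w - (u x + cone beta H b (enorm (w - x)))) / 3.
have e0 : 0 < e by rewrite divr_gt0// subr_gt0.
have eE : u w = u x + cone beta H b (enorm (w - x)) + 3 * e by rewrite /e; field.
clearbody e.
have [d1 d10 c1] := cone_near beta H b (enorm (w - x)) e0.
have [d2 d20 c2] := cone_near beta H b r e0.
have [d3 d30 c3] := usc_enorm su.1 Kx e0.
pose d := Num.min (Num.min d1 d2) (Num.min d3 ((r - enorm (w - x)) / 2)).
have d0 : 0 < d by rewrite !lt_min d10 d20 d30 divr_gt0// subr_gt0.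
have [c Oc] := closure_enorm Kx d0.
rewrite !lt_min => /andP[/andP[cd1 cd2] /andP[cd3 cd4]].
have cx0 := enorm_ge0 (c - x); have wx0 := enorm_ge0 (w - x).
have cx : enorm (x - c) = enorm (c - x) by exact: enormB.
(* The ball of radius [s] about [c] lies in the ball of radius [r] about [x], where [reg] and [um]
   are available. *)
pose s := r - enorm (c - x).
have s0 : 0 < s by rewrite /s; clear -oO bO nuO su Kx r0 reg um cd4 cx0 wx0 wr; lra.
have inb y : enorm (y - x) <= enorm (y - c) + enorm (c - x) by exact: enorm_triangle.
have wc : enorm (w - c) <= enorm (w - x) + enorm (c - x).
  by rewrite -cx; exact: enorm_triangle.
have [||w0 [Kw0 w0c _ mx]] := @cone_ball_max c s H b Oc s0.
- move=> y Ky ys; apply: reg => //; have i1 := inb y; move: ys; rewrite /s.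
  by clear -oO bO nuO su Kx r0 reg um i1; lra.
- move=> t /andP[t0 ts]; apply: dc; rewrite t0/=; move: ts; rewrite /s.
  by clear -oO bO nuO su Kx r0 reg um cx0; lra.
have ws : enorm (w - c) <= s by rewrite /s; clear -oO bO nuO su Kx r0 reg um wc cd4 cx0 wx0 wr; lra.
have := mx w Kw ws.
have := c1 (enorm (w - c)).
have -> : `|enorm (w - c) - enorm (w - x)| < d1.
  apply: (le_lt_trans (ler_dist_enorm _ _)).
  by rewrite opprB addrC subrKA cx.
move=> /(_ isT); rewrite ltr_distl => /andP[_ k1].
case: w0c => [->|w0s].
  rewrite subrr enorm0 cone0.
  have := c3 c (subset_closure Oc) cd3.
  move=> h1 h2; clear -oO bO nuO su Kx r0 reg um k1 h1 h2 eE e0.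
  move: (cone _ _ _ _) (cone _ _ _ _) k1 h2 eE => g1 g2 k1 h2 eE; lra.
have := um Kw0; have := inb w0; rewrite w0s => i1.
have {i1}i1 : enorm (w0 - x) <= r by rewrite /s in i1; clear -oO bO nuO su Kx r0 reg um i1; lra.
move=> /(_ i1).
have := c2 s.
have -> : `|s - r| < d2.
  by rewrite /s addrAC subrr add0r normrN ger0_norm.
move=> /(_ isT); rewrite ltr_distl => /andP[k2 _].
move=> h1 h2; clear -oO bO nuO su Kx r0 reg um k1 k2 mc h1 h2 eE e0.
move: (cone _ _ _ s) (cone _ _ _ r) (cone _ _ _ (enorm (w - c))) (cone _ _ _ (enorm (w - x)))
  k1 k2 mc h2 eE => g1 g2 g3 g4 k1 k2 mc h2 eE; lra.
Qed.

(** With slope [0] the maximum of [u] minus the cone is taken on the sphere, where [u] is at most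
    [m]; comparing with the value at [x] bounds [m] from below. *)
Lemma cone0_bound : (0 < n)%N -> (forall s, 0 < s < r -> 0 < dcone beta H 0 s) ->
  u x + cone beta H 0 r <= m.
Proof.
move=> n0 dc; rewrite leNgt; apply/negP => lt.
pose e := (u x + cone beta H 0 r - m) / 3.
have e0 : 0 < e by rewrite divr_gt0// subr_gt0.
have eE : u x + cone beta H 0 r = m + 3 * e by rewrite /e; field.
clearbody e.
have [d1 d10 c1] := cone_near beta H 0 0 e0.
have [d2 d20 c2] := cone_near beta H 0 r e0.
pose d := Num.min (Num.min d1 d2) (r / 2).
have d0 : 0 < d by rewrite !lt_min d10 d20 divr_gt0.
have [c Oc] := closure_enorm Kx d0.
rewrite !lt_min => /andP[/andP[cd1 cd2] cd4].
have cx0 := enorm_ge0 (c - x).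
have cx : enorm (x - c) = enorm (c - x) by exact: enormB.
pose s := r - enorm (c - x).
have s0 : 0 < s by rewrite /s; clear -oO bO nuO su Kx r0 reg um cd4 cx0; lra.
have inb y : enorm (y - x) <= enorm (y - c) + enorm (c - x) by exact: enorm_triangle.
have [||w0 [Kw0 _ /(_ erefl n0) w0s mx]] := @cone_ball_max c s H 0 Oc s0.
- move=> y Ky ys; apply: reg => //; have i1 := inb y; move: ys; rewrite /s.
  by clear -oO bO nuO su Kx r0 reg um i1; lra.
- move=> t /andP[t0 ts]; apply: dc; rewrite t0/=; move: ts; rewrite /s.
  by clear -oO bO nuO su Kx r0 reg um cx0; lra.
have ws : enorm (x - c) <= s by rewrite cx /s; clear -oO bO nuO su Kx r0 reg um cd4; lra.
have := mx x Kx ws.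
have := c1 (enorm (x - c)).
have -> : `|enorm (x - c) - 0| < d1 by rewrite subr0 ger0_norm cx.
move=> /(_ isT); rewrite ltr_distl => /andP[_].
rewrite cone0 => k1.
have := um Kw0; have := inb w0; rewrite w0s => i1.
have {i1}i1 : enorm (w0 - x) <= r by rewrite /s in i1; clear -oO bO nuO su Kx r0 reg um i1; lra.
move=> /(_ i1).
have := c2 s.
have -> : `|s - r| < d2.
  by rewrite /s addrAC subrr add0r normrN ger0_norm.
move=> /(_ isT); rewrite ltr_distl => /andP[k2 _].
move=> h1 h2; clear -oO bO nuO su Kx r0 reg um k1 k2 h1 h2 eE e0.
move: (cone _ _ _ s) (cone _ _ _ r) (cone _ _ _ (enorm (x - c)))
  k1 k2 h2 eE => g1 g2 g3 k1 k2 h2 eE; lra.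
Qed.

End Center.

(** The cone with vertex [x] that reaches [m - u x] at radius [2 * e] bounds the increment of [u].
    For [H != 0] its initial derivative is positive wherever it is used, even when [m = u x]. *)
Lemma finite_difference x H (m e : R) w : (0 < n)%N -> H != 0 -> 0 < e -> closure O x ->
  (forall w, closure O w -> enorm (w - x) < 2 * e -> (O `|` GammaN O A) w /\ h w < H) ->
  (forall w, closure O w -> enorm (w - x) <= 2 * e -> u w <= m) ->
  closure O w -> enorm (w - x) <= e ->
  u w - u x <= fdp beta e * (m - u x) + H * fdk beta e.
Proof.
move=> n0 H0 e0 Kx reg um Kw we.
have e20 : 0 < 2 * e by rewrite mulr_gt0.
have M0 : 0 <= m - u x.
  by rewrite subr_ge0; apply: um => //; rewrite subrr enorm0 ltW.
have [] := cone_double beta H (m - u x) e0.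
set b := _ / _ => c2 c1; rewrite -c1 lerBlDl.
have mono r : e <= r -> (forall s, 0 < s < r -> 0 < dcone beta H b s) ->
    cone beta H b (enorm (w - x)) <= cone beta H b e.
  move=> er dc; apply: (derive_homo_le (is_derive_cone beta H b) we).
  move=> z /andP[wz ze]; apply: ltW; apply: dc.
  by rewrite (le_lt_trans (enorm_ge0 _) wz) (lt_le_trans ze).
have [Hn|Hp] := ltP H 0.
  have dc0 s : 0 < s -> 0 < - H * expint beta s.
    by move=> s0; rewrite mulr_gt0 ?expint_gt0// oppr_gt0.
  (* The numerator of [b] is [m - (u x + cone beta H 0 (2 * e))], nonnegative by [cone0_bound]. *)
  have b0 : 0 <= b.
    have := @cone0_bound x H m (2 * e) Kx e20 reg um n0 => k.
    rewrite /b divr_ge0//; last by rewrite ltW// expint_gt0.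
    have : u x + cone beta H 0 (2 * e) <= m.
      by apply: k => s /andP[s0 _]; have := dc0 s s0; rewrite /dcone mul0r sub0r mulNr; exact.
    by rewrite /cone mul0r; clear -oO bO nuO su; lra.
  have dc s : 0 < s < 2 * e -> 0 < dcone beta H b s.
    move=> /andP[s0 _]; rewrite /dcone -[- (H * _)]mulNr ltr_wpDl// ?dc0//.
    by rewrite mulr_ge0// expR_ge0.
  have := @cone_bound x H m (2 * e) Kx reg um b w dc.
  rewrite c2 lexx => /(_ isT Kw) /(_ ltac:(lra)).
  have := mono (2 * e) ltac:(lra) dc; lra.
have {Hp}Hp : 0 < H by rewrite lt_neqAle eq_sym H0.
have b0 : 0 < b.
  rewrite /b divr_gt0 ?expint_gt0// ltr_wpDl// mulr_gt0//.
  exact: expint2_gt0.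
have [r [/andP[r0 r2] dc pk]] := cone_peak beta Hp b0 e20.
(* If the peak comes no later than [e], the cone at [e] is at least its value [m - u x] at [2 * e],
   and [um] suffices. Otherwise the cone increases up to [r], and [cone_bound] applies with that
   radius. *)
have [re|er] := leP r e.
  have := pk e; rewrite re c2/= => /(_ ltac:(lra)).
  have := um w Kw ltac:(lra); lra.
have := @cone_bound x H m r Kx _ _ b w dc _ Kw (le_lt_trans we er).
have := mono r (ltW er) dc.
move=> k1 k2; apply: (le_trans (k2 _ _ _)).
- by move=> y Ky yr; apply: reg => //; exact: lt_le_trans r2.
- by move=> y Ky yr; apply: um => //; exact: le_trans r2.
- by rewrite -c2; apply: pk; rewrite lexx.
by rewrite lerD2l.
Qed.

End ConeComparison.

(** * Boundary normals, convexity and midpoints *)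

Section Geometry.
Context {R : realType} {n : nat}.
Local Notation V := 'rV[R]_n.
Implicit Types (O A U : set V) (c w x y z e : V).

Lemma norm_le_coord x (r : R) : 0 <= r -> (forall i, `|x 0 i| <= r) -> `|x| <= r.
Proof.
move=> r0 xr; rewrite [leLHS]/Num.norm/= mx_normrE; apply: bigmax_le => //.
by move=> [i j] _; rewrite (ord1 i)/=.
Qed.

Lemma is_derive_line (f : V -> R) (p v : V) (s r : R) :
  derivable f (p + (s * r) *: v) v ->
  is_derive r 1 (fun r => f (p + (s * r) *: v)) (s * 'D_v f (p + (s * r) *: v)).
Proof.
set q := p + _ => df.
pose g t := f (t *: v + q).
have Dg : is_derive (0 : R) 1 g ('D_v f q).
  have E : (fun h : R => h^-1 *: ((g \o shift 0) (h *: 1) - g 0)) =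
           (fun h => h^-1 *: ((f \o shift q) (h *: v) - f q)).
    by apply/funext => h; rewrite /= /g scale0r add0r addr0 /GRing.scale/= mulr1.
  apply: DeriveDef; first by rewrite /derivable E.
  by rewrite /derive E.
have Dl : is_derive r 1 (fun t : R => s *: (t - r)) s.
  have h1 : is_derive r 1 (fun t : R => t - r) 1.
    have := is_deriveB (is_derive_id r 1) (is_derive_cst r r 1).
    by rewrite subr0.
  by have := is_deriveZ s h1; rewrite /GRing.scale/= mulr1.
have Dg' : is_derive (s *: (r - r) : R) 1 g ('D_v f q) by rewrite subrr scaler0.
have := @is_derive1_comp R g (fun t : R => s *: (t - r)) r _ _ Dg' Dl.
rewrite mulrC; congr (is_derive _ _ _ _).
apply/funext => t; rewrite /= /g /q addrCA -scalerDl; congr (f (_ + _ *: _)).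
by rewrite /GRing.scale/= mulrBr subrK.
Qed.

(** The path from [w] to [w + t *: e] is taken one coordinate at a time, with the mean value theorem
    on each edge; there the partial derivatives are close to their values at [w]. *)
Lemma C1_first_order U (f : V -> R) w e (eta : R) :
  open U -> U w -> C1_on U f -> 0 < eta ->
  exists2 d : R, 0 < d & forall t, 0 < t < d ->
    `|f (w + t *: e) - f w - t * dotp e (grad f w)| <= eta * t.
Proof.
move=> oU Uw fC eta0.
have n1 : 0 < (n.+1%:R : R) by [].
have e1 : 0 < 1 + `|e| by rewrite ltr_pwDl.
pose eta' := eta / (n.+1%:R * (1 + `|e|)).
have eta'0 : 0 < eta' by rewrite divr_gt0// mulr_gt0.
have : \forall q \near w, U q /\ forall i, `|pderiv i f w - pderiv i f q| <= eta'.
  near=> q; split; first by near: q; exact: open_nbhs_nbhs.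
  near: q; apply: filter_forall => i.
  have [_ /(_ i)[_ /cvgrPdist_le]] := fC w Uw.
  exact.
move=> /nbhs_ballP[r r0]; rewrite -ball_normE/= => hr'.
have hr q : `|w - q| < r -> U q /\ forall i, `|pderiv i f w - pderiv i f q| <= eta'.
  by move=> wq; exact: hr'.
exists (r / (1 + `|e|)); first by rewrite divr_gt0.
move=> t /andP[t0]; rewrite ltr_pdivlMr// => tr.
(* [ek k] keeps the first [k] coordinates of [e], so consecutive points [p k] differ along one axis
   only. *)
pose ek k : V := \row_j (if (j < k)%N then e 0 j else 0).
pose p k : V := w + t *: ek k.
have pS (k : 'I_n) : p k.+1 = p k + (t * e 0 k) *: evec k.
  rewrite /p -addrA -scalerA -scalerDr; congr (_ + _ *: _).
  apply/rowP => j; rewrite !mxE eqxx/= ltnS leq_eqVlt.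
  have [jk|jk] := eqVneq (j : nat) k.
    by have -> : j = k by [apply: val_inj]; rewrite ltnn eqxx add0r mulr1.
  by rewrite -val_eqE (negbTE jk)/= mulr0 addr0.
have near_w (k : 'I_n) (s : R) : 0 <= s <= 1 ->
    `|w - (p k + (t * e 0 k * s) *: evec k)| < r.
  move=> /andP[s0 s1]; apply: le_lt_trans tr; rewrite distrC /p addrAC.
  rewrite [w + _]addrC addrK.
  have te0 : 0 <= t * `|e| by rewrite mulr_ge0// ltW.
  apply: (@le_trans _ _ (t * `|e|)); last first.
    by rewrite mulrDr mulr1 lerDr ltW.
  apply: norm_le_coord => // j; rewrite !mxE eqxx/=.
  have cj := coord_le_norm e j; have ck := coord_le_norm e k.
  have [->|jk] := eqVneq j k.
    rewrite ltnn mulr0 add0r mulr1 !normrM (gtr0_norm t0) (ger0_norm s0).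
    rewrite -mulrA ler_wpM2l ?(ltW t0)//.
    by apply: le_trans ck; rewrite ler_piMr.
  rewrite mulr0 addr0 normrM (gtr0_norm t0) ler_wpM2l ?(ltW t0)//.
  by case: ifP => // _; rewrite normr0.
have step (k : 'I_n) :
    `|f (p k.+1) - f (p k) - t * (e 0 k * pderiv k f w)| <= t * `|e| * eta'.
  pose F s := f (p k + (t * e 0 k * s) *: evec k).
  have DF (s : R) : 0 <= s <= 1 -> is_derive s 1 F
      (t * e 0 k * pderiv k f (p k + (t * e 0 k * s) *: evec k)).
    move=> s01; apply: is_derive_line.
    have [Uq _] := hr _ (near_w k s s01).
    by have [_ /(_ k)[]] := fC _ Uq.
  have [||s s01 Es] := @MVT_segment R F
    (fun s => t * e 0 k * pderiv k f (p k + (t * e 0 k * s) *: evec k)) 0 1 ler01.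
  - move=> s; rewrite in_itv/= => /andP[s0 s1]; apply: DF.
    by rewrite !ltW.
  - apply: derivable_within_continuous => s; rewrite in_itv/= => s01.
    exact: (@ex_derive _ _ _ _ _ _ _ (DF s s01)).
  move: s01 Es; rewrite in_itv/= => s01.
  rewrite /F mulr1 mulr0 scale0r addr0 -pS subr0 mulr1 => ->.
  have [_ /(_ k) hq] := hr _ (near_w k s s01).
  rewrite [t * (e 0 k * _)]mulrA -mulrBr distrC in hq *.
  rewrite normrM; apply: ler_pM => //.
  by rewrite normrM (gtr0_norm t0) ler_wpM2l ?(ltW t0)// coord_le_norm.
have -> : f (w + t *: e) - f w - t * dotp e (grad f w)
   = \sum_(k < n) (f (p k.+1) - f (p k) - t * (e 0 k * pderiv k f w)).
  rewrite sumrB; congr (_ - _); last first.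
    by rewrite -mulr_sumr; congr (_ * _); apply: eq_bigr => k _; rewrite mxE.
  have := telescope_sumr (fun k => f (p k)) (leq0n n); rewrite big_mkord => ->.
  congr (f _ - f _).
    by congr (_ + _ *: _); apply/rowP => j; rewrite mxE ltn_ord.
  have ek0 : ek 0%N = 0 by apply/rowP => j; rewrite !mxE ltn0.
  by rewrite /p ek0 scaler0 addr0.
apply: (le_trans (ler_norm_sum _ _ _)).
apply: (@le_trans _ _ (\sum_(k < n) t * `|e| * eta')); first exact: ler_sum.
rewrite sumr_const card_ord -mulr_natl.
have -> : eta * t = n.+1%:R * (t * (1 + `|e|) * eta').
  by rewrite /eta'; field; rewrite !gt_eqF.
apply: ler_pM => //.
- by rewrite !mulr_ge0// ltW.
- by rewrite ler_nat.
by rewrite ler_wpM2r ?(ltW eta'0)// ler_wpM2l ?(ltW t0)// lerDr.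
Unshelve. all: by end_near. Qed.

(** The point equals [(1 - t) *: w' + t *: c'], with [w'] in [O] close to [w] and [c'] a small
    correction of [c] that stays in the open set [O]. *)
Lemma convex_closure_segment O c w (t : R) : open O -> convex_setV O ->
  O c -> closure O w -> 0 < t <= 1 -> O (w + t *: (c - w)).
Proof.
move=> oO cO Oc clw /andP[t0 t1].
have [d d0 hd] := open_enorm oO Oc.
have [w' Ow' ww'] := closure_enorm clw (mulr_gt0 d0 t0).
pose c' := c + ((1 - t) / t) *: (w - w').
have Oc' : O c'.
  apply: hd; rewrite /c' addrAC subrr add0r enormZ.
  rewrite ger0_norm ?divr_ge0 ?subr_ge0// ?(ltW t0)// enormB.
  rewrite mulrAC ltr_pdivrMr//; apply: le_lt_trans ww'.
  by rewrite ler_piMl ?enorm_ge0// gerBl ltW.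
have := cO w' c' t Ow' Oc'; rewrite (ltW t0) t1 => /(_ isT).
congr (O _); rewrite /c'; apply/rowP => i; rewrite !mxE; field.
by rewrite gt_eqF.
Qed.

(** Points of the segment from [w] to a point [c'] of [O] lie in [O], where [rho < 0 <= rho w]; so
    the derivative of [rho] at [w] towards [c'] is at most [0]. *)
Lemma outward_normal_gt0 O nu c w : open O -> convex_setV O ->
  C1_boundary_normal O nu -> bdry O w -> O c -> 0 < dotp (w - c) (nu w).
Proof.
move=> oO cO hnu bw Oc.
have [U [rho [oU Uw C1 g0 [Orho nuE]]]] := hnu w bw.
have g0w := g0 w Uw.
rewrite (nuE w Uw bw) dotpZr mulr_gt0 ?invr_gt0 ?enorm_gt0//.
set g := grad rho w in g0w *.
have nOw : ~ O w by case: bw => _; apply: contra_not => Ow; exact: open_nbhs_nbhs.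
have rw : 0 <= rho w by rewrite leNgt; apply/negP => /(Orho w Uw).
have le c' : O c' -> dotp (c' - w) g <= 0.
  move=> Oc'; rewrite leNgt; apply/negP => dp.
  have dp2 : 0 < dotp (c' - w) g / 2 by rewrite divr_gt0.
  have [d d0 hd] := C1_first_order (c' - w) oU Uw C1 dp2.
  have [d' d'0 hU] := open_enorm oU Uw.
  have e0 := enorm_ge0 (c' - w).
  have e1 : 0 < 1 + enorm (c' - w) by rewrite ltr_pwDl.
  pose t := Num.min (Num.min d 1) (d' / (1 + enorm (c' - w))) / 2.
  have m0 : 0 < Num.min (Num.min d 1) (d' / (1 + enorm (c' - w))).
    by rewrite !lt_min d0 ltr01 divr_gt0.
  have t0 : 0 < t by rewrite divr_gt0.
  have : t < Num.min (Num.min d 1) (d' / (1 + enorm (c' - w))).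
    by rewrite /t ltr_pdivrMr// ltr_pMr// ltr1n.
  rewrite !lt_min => /andP[/andP[td t1] td'].
  have Ut : U (w + t *: (c' - w)).
    apply: hU; rewrite addrAC subrr add0r enormZ gtr0_norm//.
    move: td'; rewrite ltr_pdivlMr// mulrDr mulr1; apply: le_lt_trans.
    by rewrite lerDr ltW.
  have Ot : O (w + t *: (c' - w)).
    by apply: convex_closure_segment; rewrite ?t0 ?(ltW t1)//; case: bw.
  have /(Orho _ Ut) := Ot.
  have := hd t; rewrite t0 td => /(_ isT); rewrite ler_distl -/g => /andP[h1 _] h2.
  have h3 := mulr_gt0 dp2 t0.
  move: (rho _) h1 h2 => r' h1 h2.
  have : t * dotp (c' - w) g = 2 * (dotp (c' - w) g / 2 * t) by field.
  move: (dotp _ _ / 2 * t) h3 h1 => k h3 h1 E; rewrite E in h1.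
  by clear -rw h1 h2 h3; lra.
have [d d0 hd] := open_enorm oO Oc.
have eg0 : 0 < enorm g by rewrite enorm_gt0.
(* Pushing [c] a distance [d / 2] along the gradient keeps it in [O] and makes the weak inequality
   strict. *)
pose t := d / 2 / enorm g.
have t0 : 0 < t by rewrite !divr_gt0.
have /le : O (c + t *: g).
  apply: hd; rewrite addrAC subrr add0r enormZ gtr0_norm// /t divfK ?gt_eqF//.
  by rewrite ltr_pdivrMr// ltr_pMr// ltr1n.
have -> : c + t *: g - w = - (w - c) + t *: g by rewrite opprB addrAC.
rewrite (dotpDl _ (t *: g)) dotpNl (dotpZl t g).
have : 0 < t * dotp g g by rewrite mulr_gt0// dotp_gt0.
by rewrite addrC subr_le0; exact: lt_le_trans.
Qed.

(** If [GammaN] is nonempty, convexity applies. If it is empty, the ball about [y] contains no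
    boundary point at all, and the segment cannot leave [O]. *)
Lemma midpoint_closure O A y z : open O ->
  (GammaN O A !=set0 -> convex_setV O) -> closure O y -> closure O z ->
  (forall q, enorm (q - y) <= enorm (z - y) -> ~ GammaD O A q) ->
  closure O (y + 2^-1 *: (z - y)).
Proof.
move=> oO cO Ky Kz nD.
have [[q Nq]|N0] := pselect (GammaN O A !=set0).
  have {}cO : convex_setV O by apply: cO; exists q.
  move=> B /nbhs_enormP[d d0 hB].
  have [y' Oy' yy'] := closure_enorm Ky d0.
  have [z' Oz' zz'] := closure_enorm Kz d0.
  exists ((1 - 2^-1) *: y' + 2^-1 *: z'); split.
    by apply: cO => //; lra.
  apply: hB.
  have -> : (1 - 2^-1) *: y' + 2^-1 *: z' - (y + 2^-1 *: (z - y))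
     = 2^-1 *: (y' - y) + 2^-1 *: (z' - z).
    by apply/rowP => i; rewrite !mxE; field.
  apply: (le_lt_trans (enormD _ _)); rewrite !enormZ gtr0_norm ?invr_gt0//.
  by clear -yy' zz'; lra.
have inO q : closure O q -> enorm (q - y) <= enorm (z - y) -> O q.
  move=> Kq qy; apply: contrapT => nO; apply: (nD q qy).
  have bq : bdry O q by split=> // qi; apply: nO; exact: nbhs_singleton.
  by split=> // Aq; apply: N0; exists q.
pose f (t : R) := y + t *: (z - y).
have cf (t : R) : {for t, continuous f}.
  by apply: continuousD; [exact: cst_continuous | exact: scalel_continuous].
have inb t : 0 <= t <= 1 -> enorm (f t - y) <= enorm (z - y).
  move=> /andP[t0 t1]; rewrite /f addrAC subrr add0r enormZ ger0_norm//.
  by rewrite ler_piMl ?enorm_ge0.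
(* The set of times at which the segment is in [O] is nonempty, open and closed in the interval. *)
have : `[0, 1]%classic `&` f @^-1` O = `[0, 1]%classic.
  apply: (@segment_connected R 0 1).
  - exists 0; split; first by rewrite /= in_itv/= lexx ler01.
    by rewrite /= /f scale0r addr0; apply: inO => //; rewrite subrr enorm0 enorm_ge0.
  - by exists (f @^-1` O) => //; apply: open_comp => // t _; exact: cf.
  - exists (f @^-1` closure O).
      by apply: closed_comp => [t _|]; [exact: cf | exact: closed_closure].
    apply/seteqP; split=> t [t01 Ot]; split=> //; first exact: subset_closure.
    by apply: inO => //; apply: inb; move: t01; rewrite /= in_itv.
move=> /seteqP[_ /(_ 2^-1)]; rewrite /= in_itv/= => h.
have [|_ Oh] := h; last exact: subset_closure.
by lra.
Qed.

(** A test function [phi] for [- v] at a maximum becomes [- phi] for [v] at a minimum, and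
    [inf_lap_minus] is defined by this reflection. *)
Lemma supersolution_opp O A nu beta (ht v : V -> R) :
  supersolution O A nu beta ht v ->
  subsolution O A nu (- beta) (fun x => - ht x) (fun x => - v x).
Proof.
move=> [lv sv]; split=> // phi Cphi x0 Ox0 [d d0 mx].
have [c0 [d1 [c1 [d2 c2]]]] := Cphi.
have pN (f : V -> R) i : (forall x, derivable f x (evec i)) ->
    pderiv i (fun y => - f y) = (fun y => - pderiv i f y).
  by move=> df; apply/funext => x; rewrite /pderiv; apply: (deriveN (df x)).
have p1 i : pderiv i (fun y => - phi y) = (fun y => - pderiv i phi y).
  exact: (pN phi i (d1 i)).
have p2 i j : pderiv j (pderiv i (fun y => - phi y)) = (fun y => - pderiv j (pderiv i phi) y).
  rewrite p1; exact: (pN _ j (d2 i j)).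
have cN (f : V -> R) : continuous f -> continuous (fun y => - f y).
  by move=> cf x; apply: (@continuousN _ _ _ f); exact: cf.
have CN : C2 (fun y => - phi y).
  split; first exact: cN.
  split; first by move=> i x; apply: (derivableN (d1 i x)).
  split; first by move=> i; rewrite p1; exact: cN.
  split; first by move=> i j x; rewrite p1; apply: (derivableN (d2 i j x)).
  by move=> i j; rewrite p2; exact: cN.
have gN : grad (fun y => - phi y) x0 = - grad phi x0.
  by apply/rowP => i; rewrite !mxE p1.
have lm : loc_min_rel (closure O) (fun y => v y - - phi y) x0.
  exists d => // y Ky yd; have := mx y Ky yd.
  by rewrite !opprK -!opprD lerN2.
have NN : (fun y => - - phi y) = phi by apply/funext => y; rewrite opprK.
have [|[Nx]] := sv _ CN x0 Ox0 lm.
  rewrite /inf_lap_minus NN gN enormN opprK => h; left.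
  by rewrite mulNr opprK -lerN2 opprK opprD opprK; exact: h.
by rewrite gN dotpNl oppr_ge0 => h; right.
Qed.

End Geometry.

(** * Superlevel sets and the algebra of the two inequalities *)

Lemma compact_usc_superlevel {R : realType} (T : topologicalType) (C : set T)
    (f : T -> R) (c : R) : compact C ->
  (forall x, C x -> forall c, f x < c -> \forall y \near x, C y -> f y < c) ->
  compact (C `&` [set x | c <= f x]).
Proof.
move=> cC uf F FF FE.
have FC : F C by apply: filterS FE => x [].
have [x [Cx clx]] := cC F FF FC.
exists x; split=> //; split=> //=; rewrite leNgt; apply/negP => xc.
have [y [[Cy /= cy] /(_ Cy)]] := clx _ _ FE (uf x Cx c xc).
by rewrite ltNge cy.
Qed.

(** Add the two inequalities and replace [b] by [d] and [c] by [a]: the weights sum to [1], and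
    [a + d <= a + d - (H2 - H1) * k] remains. *)
Lemma strict_fd_absurd {R : realFieldType} (p k H1 H2 a b c d : R) :
  0 < p < 1 -> 0 < k -> H1 < H2 -> b <= d -> c <= a ->
  a <= p * (a + b) + H1 * k -> d <= (1 - p) * (c + d) - H2 * k -> False.
Proof.
move=> /andP[p0 p1] k0 H12 bd ca h1 h2.
have i1 : 0 <= p * (d - b) by rewrite mulr_ge0 ?subr_ge0// ltW.
have i2 : 0 <= (1 - p) * (a - c) by rewrite mulr_ge0 ?subr_ge0// ltW.
have i3 : 0 < (H2 - H1) * k by rewrite mulr_gt0// subr_gt0.
by lra.
Qed.

(** The same addition now leaves no slack, so all the inequalities are equalities. *)
Lemma fd_rigidity {R : realFieldType} (p a b c d : R) :
  0 < p < 1 -> b <= d -> c <= a ->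
  a <= p * (a + b) -> d <= (1 - p) * (c + d) -> [/\ b = d, c = a & (1 - p) * a = p * b].
Proof.
move=> /andP[p0 p1] bd ca h1 h2.
have q0 : 0 < 1 - p by rewrite subr_gt0.
have i1 : 0 <= p * (d - b) by rewrite mulr_ge0 ?subr_ge0// ltW.
have i2 : 0 <= (1 - p) * (a - c) by rewrite mulr_ge0 ?subr_ge0// ltW.
have e1 : p * (d - b) = 0 by lra.
have e2 : (1 - p) * (a - c) = 0 by lra.
split; last by lra.
  by move: e1 => /eqP; rewrite mulf_eq0 gt_eqF//= subr_eq0 => /eqP.
by move: e2 => /eqP; rewrite mulf_eq0 (gt_eqF q0)/= subr_eq0 => /eqP.
Qed.

(** If [b <= 0], everything between is negative; otherwise [a] is first raised to at least [0].
    Nonzero values are what [fd_subsolution] accepts. *)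
Lemma two_nonzero_between {R : realFieldType} (a b : R) : a < b ->
  exists H1 H2, [/\ H1 != 0, H2 != 0, a < H1, H1 < H2 & H2 < b].
Proof.
move=> ab; have [b0|b0] := leP b 0.
  exists (a + (b - a) / 3), (a + (b - a) / 3 * 2).
  by split; [rewrite lt_eqF//; lra | rewrite lt_eqF//; lra | lra | lra | lra].
pose a' := Num.max a 0.
have [aa' a0] : a <= a' /\ 0 <= a' by rewrite !le_max !lexx orbT.
have a'b : a' < b by rewrite gt_max ab.
move: a' aa' a0 a'b => a' aa' a0 a'b.
exists (a' + (b - a') / 3), (a' + (b - a') / 3 * 2).
by split; [rewrite gt_eqF//; lra | rewrite gt_eqF//; lra | lra | lra | lra].
Qed.

Lemma lerB_cross {R : realFieldType} (a b c d : R) : a + b <= c + d -> a - c <= d - b.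
Proof. by move=> ?; lra. Qed.

Lemma half_le_minus {R : realFieldType} (d e : R) : 0 < e -> 8 * e <= d -> d / 2 <= d - e.
Proof. by move=> ? ?; lra. Qed.

(** * The finite difference inequality as a property of functions *)

Section Discrete.
Context {R : realType} {n : nat}.
Local Notation V := 'rV[R]_n.
Implicit Types (O A : set V) (q w x y z : V).

(** A Lebesgue number argument: a local radius serves a whole neighbourhood, and since [Q] survives
    shrinking, compactness leaves one radius for all of [C]. *)
Lemma compact_uniform_radius (C : set V) (Q : V -> R -> Prop) : compact C ->
  (forall x r s, 0 < s <= r -> Q x r -> Q x s) ->
  (forall x, C x -> exists2 r : R, 0 < r & forall y, enorm (y - x) < r -> Q y r) ->
  exists2 r : R, 0 < r & forall x, C x -> Q x r.
Proof.
move=> /compact_near_coveringP cC Qm loc.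
have N0 : \forall r \near (0 : R)^'+, C `<=` (fun x => Q x r).
  apply: (cC R _ (fun r x => Q x r)) => x Cx.
  have [r r0 hr] := loc x Cx.
  exists ([set y | enorm (y - x) < r], [set s : R | 0 < s <= r]).
    split=> /=; first by apply/nbhs_enormP; exists r.
    near=> s; apply/andP; split; near: s; first exact: nbhs_right_gt.
    exact: nbhs_right_le.
  by move=> [y s] [/= yr sr]; apply: Qm sr _; exact: hr.
have [r [r0 Cr]] : exists r : R, 0 < r /\ C `<=` (fun x => Q x r).
  near ((0 : R)^'+) => r; exists r; split; near: r; [exact: nbhs_right_gt|exact: N0].
by exists r.
Unshelve. all: by end_near. Qed.

(** The conclusion of [finite_difference]; the comparison below uses the equation only through
    it. *)
Definition fd_subsolution O A (beta : R) (h u : V -> R) : Prop :=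
  forall x (H m e : R) z, H != 0 -> 0 < e -> closure O x ->
  (forall w, closure O w -> enorm (w - x) < 2 * e -> (O `|` GammaN O A) w /\ h w < H) ->
  (forall w, closure O w -> enorm (w - x) <= 2 * e -> u w <= m) ->
  closure O z -> enorm (z - x) <= e ->
  u z - u x <= fdp beta e * (m - u x) + H * fdk beta e.

Lemma fd_subsolutionZ O A beta h u (k : R) : 0 < k ->
  fd_subsolution O A beta h u ->
  fd_subsolution O A beta (fun x => k * h x) (fun x => k * u x).
Proof.
move=> k0 fu x H m e z H0 e0 Kx reg um Kz ze.
have kn : k != 0 by rewrite gt_eqF.
have := fu x (H / k) (m / k) e z _ e0 Kx _ _ Kz ze.
have -> : k * u z - k * u x = k * (u z - u x) by rewrite mulrBr.
have -> : fdp beta e * (m - k * u x) + H * fdk beta e =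
   k * (fdp beta e * (m / k - u x) + H / k * fdk beta e) by field.
rewrite ler_pM2l//; apply.
- by rewrite mulf_neq0// invr_neq0.
- by move=> v Kv vx; have [Dv hv] := reg v Kv vx; split=> //; rewrite ltr_pdivlMr// mulrC.
- by move=> v Kv vx; rewrite ler_pdivlMr// mulrC; exact: um.
Qed.

(** The case [H = 0] is reached through positive [H] tending to [0]; [H = t / fdk beta e] costs
    exactly [t]. *)
Lemma fd_subsolution0 O A beta h u x (m e : R) z : fd_subsolution O A beta h u ->
  (forall x, (O `|` GammaN O A) x -> h x <= 0) ->
  0 < e -> closure O x ->
  (forall w, closure O w -> enorm (w - x) < 2 * e -> (O `|` GammaN O A) w) ->
  (forall w, closure O w -> enorm (w - x) <= 2 * e -> u w <= m) ->
  closure O z -> enorm (z - x) <= e ->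
  u z - u x <= fdp beta e * (m - u x).
Proof.
move=> fu h0 e0 Kx reg um Kz ze; apply/ler_addgt0Pr => t t0.
have k0 := fdk_gt0 beta e0.
have tk : 0 < t / fdk beta e by rewrite divr_gt0.
have := fu x (t / fdk beta e) m e z _ e0 Kx _ um Kz ze.
rewrite divfK ?gt_eqF//; apply=> // v Kv vx.
have Dv := reg v Kv vx; split=> //; exact: le_lt_trans (h0 v Dv) tk.
Qed.

Lemma closure_domain O A x : open O -> closure O x -> ~ GammaD O A x ->
  (O `|` GammaN O A) x.
Proof.
move=> oO Kx nD; have [Ox|nO] := pselect (O x); first by left.
have bx : bdry O x by split=> // xi; apply: nO; exact: nbhs_singleton.
by have [Ax|nA] := pselect (A x); [right | case: nD].
Qed.

Lemma compact_GammaD O A : open O -> bounded_setV O -> open A -> compact (GammaD O A).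
Proof.
move=> oO bO oA.
have -> : GammaD O A = closure O `&` (~` (interior O) `&` ~` A).
  by rewrite /GammaD /bdry !setDE setIA.
apply: compact_closedI; first exact: bounded_compact_closure.
by apply: closedI; apply: open_closedC => //; exact: open_interior.
Qed.

(** * Contradiction from a value above the boundary maximum *)

Section Comparison.
Variables (O A : set V) (beta m : R) (h g u v : V -> R).
Hypotheses (oO : open O) (cO : connected O) (bO : bounded_setV O) (oA : open A).
Hypothesis D0 : GammaD O A !=set0.
Hypothesis convN : GammaN O A !=set0 -> convex_setV O.
Hypotheses (uu : usc_on (closure O) u) (uv : usc_on (closure O) v).
Hypotheses (uh : usc_on (O `|` GammaN O A) h) (ug : usc_on (O `|` GammaN O A) g).
Hypothesis fu : fd_subsolution O A beta h u.
Hypothesis fv : fd_subsolution O A (- beta) g v.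
Hypothesis hD : forall q, GammaD O A q -> u q + v q <= m.
Variable p : V.
Hypothesis Kp : closure O p.
Hypothesis mp : m < u p + v p.
Local Notation S := (u p + v p).

(** At a point of [GammaD] the sum is at most [m < S]; semicontinuity extends this to nearby pairs,
    each function using half of the gap, and compactness makes the radius uniform. *)
Lemma boundary_separation : exists2 d : R, 0 < d & forall q, GammaD O A q ->
  forall y z, closure O y -> closure O z -> enorm (y - q) < d -> enorm (z - q) < d ->
  u y + v z < S.
Proof.
apply: (compact_uniform_radius (compact_GammaD oO bO oA) (Q := fun q d =>
  forall y z, closure O y -> closure O z -> enorm (y - q) < d -> enorm (z - q) < d ->
  u y + v z < S)).
  move=> q r s /andP[s0 sr] hr y z Ky Kz yq zq.
  by apply: hr => //; [exact: lt_le_trans yq sr | exact: lt_le_trans zq sr].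
move=> q Dq; have Kq : closure O q by case: Dq => -[].
have e0 : 0 < (S - m) / 2 by rewrite divr_gt0// subr_gt0.
have [d1 d10 h1] := usc_enorm uu Kq e0.
have [d2 d20 h2] := usc_enorm uv Kq e0.
exists (Num.min d1 d2 / 2); first by rewrite divr_gt0// lt_min d10.
move=> q' q'q y z Ky Kz yq zq.
have near_q t : enorm (t - q') < Num.min d1 d2 / 2 -> enorm (t - q) < Num.min d1 d2.
  move=> tq; apply: (le_lt_trans (enorm_triangle _ q' _)).
  by rewrite [ltRHS](splitr (Num.min d1 d2)) ltrD.
have := near_q y yq; rewrite lt_min => /andP[/(h1 _ Ky) uy _].
have := near_q z zq; rewrite lt_min => /andP[_ /(h2 _ Kz) vz].
have := hD Dq.
move=> hm; apply: (lt_le_trans (ltrD uy vz)).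
have -> : u q + (S - m) / 2 + (v q + (S - m) / 2) = (u q + v q) + (S - m) by field.
by rewrite -[leRHS](subrK m S) addrC lerD2l.
Qed.

Variable d : R.
Hypothesis d0 : 0 < d.
Hypothesis sep : forall q, GammaD O A q -> forall y z, closure O y -> closure O z ->
  enorm (y - q) < d -> enorm (z - q) < d -> u y + v z < S.

Lemma far_boundary x y z (e : R) : closure O y -> closure O z ->
  enorm (y - x) <= e -> enorm (z - x) <= e -> S <= u y + v z ->
  forall q, GammaD O A q -> d - e <= enorm (x - q).
Proof.
move=> Ky Kz yx zx le q Dq; rewrite leNgt; apply/negP => lt.
have near_q t : enorm (t - x) <= e -> enorm (t - q) < d.
  move=> tx; apply: (le_lt_trans (enorm_triangle _ x _)).
  by rewrite -(subrK e d) addrC ltr_leD.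
by have := sep Dq Ky Kz (near_q y yx) (near_q z zx); rewrite ltNge le.
Qed.

Definition max_pair (e : R) y z : Prop :=
  [/\ closure O y, closure O z, enorm (z - y) <= 2 * e, S <= u y + v z &
    forall y' z', closure O y' -> closure O z' -> enorm (z' - y') <= 2 * e ->
      u y' + v z' <= u y + v z].

(** Two maximizations: first the sum over the compact set of close pairs, to which [(p, p)] belongs,
    then [u y] over the compact set of maximal pairs. *)
Lemma max_pair_exists (e : R) : 0 < e -> exists y z, max_pair e y z /\
  forall y' z', max_pair e y' z' -> u y' <= u y.
Proof.
move=> e0.
pose C : set (V * V) := (closure O `*` closure O) `&` [set t | enorm (t.2 - t.1) <= 2 * e].
have cK := bounded_compact_closure bO.
have cdist : continuous (fun t : V * V => enorm (t.2 - t.1)).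
  have c1 : continuous (fun t : V * V => t.2 - t.1).
    by move=> t; apply: continuousB; [exact: cvg_snd | exact: cvg_fst].
  have c2 : continuous (fun y : V => enorm y).
    have -> : (fun y : V => enorm y) = (fun y => enorm (y - 0)).
      by apply/funext => y; rewrite subr0.
    exact: continuous_enormB.
  by move=> t; apply: (@continuous_comp _ _ _ (fun t : V * V => t.2 - t.1) _ t);
    [exact: c1 | exact: c2].
have cC : compact C.
  apply: compact_closedI; first exact: compact_setX.
  apply: (@closed_comp _ _ (fun t : V * V => enorm (t.2 - t.1)) [set r : R | r <= 2 * e]).
    by move=> t _; exact: cdist.
  exact: closed_le.
have Cp : C (p, p) by split => //=; rewrite subrr enorm0 mulr_ge0// ltW.
have usc_fst (t : V * V) : C t -> forall c, u t.1 < c -> \forall s \near t, C s -> u s.1 < c.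
  move=> [[Kt1 Kt2] _] c uc.
  have nb := usc_onP uu Kt1 uc.
  exists ([set y | closure O y -> u y < c], setT); first by split=> //; exact: filterT.
  by move=> [y z] [/= hy _] [[/= Ky _] _]; exact: hy.
have usc_sum (t : V * V) : C t -> forall c, u t.1 + v t.2 < c ->
    \forall s \near t, C s -> u s.1 + v s.2 < c.
  move=> [[Kt1 Kt2] _] c uc.
  pose k := (c - (u t.1 + v t.2)) / 2.
  have k0 : 0 < k by rewrite divr_gt0// subr_gt0.
  have uk : u t.1 < u t.1 + k by rewrite ltrDl.
  have vk : v t.2 < v t.2 + k by rewrite ltrDl.
  exists ([set y | closure O y -> u y < u t.1 + k], [set y | closure O y -> v y < v t.2 + k]).
    by split; [exact: usc_onP uu Kt1 uk | exact: usc_onP uv Kt2 vk].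
  move=> [y z] [/= hy hz] [[/= Ky Kz] _].
  have := ltrD (hy Ky) (hz Kz).
  by have -> : u t.1 + k + (v t.2 + k) = c by rewrite /k; field.
have [[y0 z0] C0 mx0] := compact_usc_max cC (ex_intro _ _ Cp) usc_sum.
pose E := C `&` [set t | u y0 + v z0 <= u t.1 + v t.2].
have cE : compact E by exact: compact_usc_superlevel.
have usc_fst' (t : V * V) : E t -> forall c, u t.1 < c -> \forall s \near t, E s -> u s.1 < c.
  by move=> [Ct _] c uc; apply: filterS (usc_fst t Ct c uc) => s hs [Cs _]; exact: hs.
have E0 : E (y0, z0) by split=> //=.
have [[y z] [[[/= Ky Kz] /= yz] /= S0] mx] := compact_usc_max cE (ex_intro _ _ E0) usc_fst'.
have mxS y' z' : closure O y' -> closure O z' -> enorm (z' - y') <= 2 * e ->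
    u y' + v z' <= u y + v z.
  by move=> Ky' Kz' yz'; apply: le_trans S0; exact: (mx0 (y', z')).
exists y, z; split.
  by split=> //; apply: mxS => //; rewrite subrr enorm0 mulr_ge0// ltW.
move=> y' z' [Ky' Kz' yz' _ mx']; apply: (mx (y', z')); split=> //=.
exact: mx' C0.1.1 C0.1.2 C0.2.
Qed.

(** [x] is the midpoint, and [y'], [z'] maximize [u], [v] on the ball of radius [2 * e] about it;
    [(y', x)] and [(x, z')] are then competitors of [(y, z)]. *)
Lemma pair_midpoint (e : R) y z : 0 < e -> 8 * e <= d -> max_pair e y z ->
  exists x y' z', [/\ [/\ closure O x, enorm (y - x) <= e & enorm (z - x) <= e],
    forall q, GammaD O A q -> d - e <= enorm (x - q),
    [/\ closure O y', enorm (y' - x) <= 2 * e, u y <= u y', u y' + v x <= u y + v z &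
      forall w, closure O w -> enorm (w - x) <= 2 * e -> u w <= u y'] &
    [/\ closure O z', enorm (z' - x) <= 2 * e, v z <= v z', u x + v z' <= u y + v z &
      forall w, closure O w -> enorm (w - x) <= 2 * e -> v w <= v z']].
Proof.
move=> e0 ed [Ky Kz yz Syz mx].
have e1 : e <= 2 * e by rewrite ler_peMl ?ler1n// ltW.
pose x := y + 2^-1 *: (z - y).
have yx : enorm (y - x) <= e.
  rewrite enormB /x addrAC subrr add0r enormZ gtr0_norm ?invr_gt0//.
  by rewrite mulrC ler_pdivrMr// mulrC.
have zx : enorm (z - x) <= e.
  have -> : z - x = 2^-1 *: (z - y) by apply/rowP => i; rewrite !mxE; field.
  rewrite enormZ gtr0_norm ?invr_gt0//.
  by rewrite mulrC ler_pdivrMr// mulrC.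
have Kx : closure O x.
  (* A point of [GammaD] this close to [y] would be within [4 * e < d] of both [y] and [z], against
     [sep]. *)
  apply: (midpoint_closure (A := A)) => // q qy Dq.
  have lt1 : enorm (y - q) < d.
    rewrite enormB; apply: (le_lt_trans qy); apply: (le_lt_trans yz).
    by apply: lt_le_trans ed; rewrite ltr_pM2r// ltr_nat.
  have lt2 : enorm (z - q) < d.
    apply: (le_lt_trans (enorm_triangle _ y _)).
    have : enorm (z - y) + enorm (y - q) <= 2 * e + 2 * e.
      by apply: lerD => //; rewrite enormB (le_trans qy).
    move=> /le_lt_trans; apply; apply: lt_le_trans ed.
    by rewrite -mulrDl ltr_pM2r// -natrD ltr_nat.
  by have := sep Dq Ky Kz lt1 lt2; rewrite ltNge Syz.
have ballmax f : usc_on (closure O) f -> exists2 y', closure O y' /\ enorm (y' - x) <= 2 * e &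
    forall w, closure O w -> enorm (w - x) <= 2 * e -> f w <= f y'.
  move=> uf; have cC : compact (closure O `&` [set w | enorm (w - x) <= 2 * e]).
    by apply: compact_closedI; [exact: bounded_compact_closure|exact: closed_enorm_ball].
  have C0 : (closure O `&` [set w | enorm (w - x) <= 2 * e]) !=set0.
    by exists y; split=> //=; exact: le_trans yx e1.
  have [y' [Ky' yy'] mx'] := usc_on_max uf (@subIsetl _ _ _) cC C0.
  by exists y' => // w Kw wx; exact: mx'.
have [y' [Ky' yx'] my'] := ballmax u uu.
have [z' [Kz' zx'] mz'] := ballmax v uv.
exists x, y', z'; split=> //.
- exact: far_boundary Ky Kz yx zx Syz.
- split=> //; first by apply: my' => //; exact: le_trans yx e1.
  by apply: mx => //; rewrite enormB.
- split=> //; first by apply: mz' => //; exact: le_trans zx e1.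
  exact: mx.
Qed.

Lemma far_domain x w (e : R) : (forall q, GammaD O A q -> d - e <= enorm (x - q)) ->
  0 < e -> 8 * e <= d -> closure O w -> enorm (w - x) <= 2 * e -> (O `|` GammaN O A) w.
Proof.
move=> far e0 ed Kw wx; apply: closure_domain => // /far; rewrite leNgt => /negP; apply.
rewrite enormB; apply: (le_lt_trans wx).
apply: (@lt_le_trans _ _ (8 * e - e)); last by rewrite lerB.
by rewrite -[X in _ - X]mul1r -mulrBl ltr_pM2r//; lra.
Qed.

Lemma fdp01 (b e : R) : 0 < fdp b e < 1.
Proof. by rewrite fdp_gt0 fdp_lt1. Qed.

(** Semicontinuity separates [h] from [- g] by constants near each point, and the points at distance
    at least [d / 2] from [GammaD] form a compact set. *)
Lemma strict_gap_radius : (forall x, (O `|` GammaN O A) x -> h x + g x < 0) ->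
  exists2 r : R, 0 < r & forall x, closure O x ->
    (forall q, GammaD O A q -> d / 2 <= enorm (x - q)) ->
    exists H1 H2, [/\ H1 != 0, H2 != 0, H1 < H2 &
      forall w, (O `|` GammaN O A) w -> enorm (w - x) < r -> h w < H1 /\ g w < - H2].
Proof.
move=> hg.
pose C := closure O `&` [set x | forall q, GammaD O A q -> d / 2 <= enorm (x - q)].
have cC : compact C.
  apply: compact_closedI; first exact: bounded_compact_closure.
  apply/closure_id/seteqP; split; first exact: subset_closure.
  move=> x clx q Dq; apply/ler_addgt0Pr => e e0.
  have [y /= /(_ q Dq) yq yx] := closure_enorm clx e0.
  rewrite (le_trans yq)// (le_trans (enorm_triangle _ x _))// addrC lerD2l.
  exact: ltW.
have [x r s /andP[_ sr] [H1 [H2 [n1 n2 lt hr]]]|x [Kx far]|r r0 hr] :=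
    compact_uniform_radius (Q := fun x r => exists H1 H2,
      [/\ H1 != 0, H2 != 0, H1 < H2 & forall w, (O `|` GammaN O A) w ->
        enorm (w - x) < r -> h w < H1 /\ g w < - H2]) cC.
- exists H1, H2; split=> // w Dw wx; apply: hr => //; exact: lt_le_trans sr.
- have Dx : (O `|` GammaN O A) x.
    apply: closure_domain => // /far; rewrite subrr enorm0 leNgt divr_gt0//.
  have ab : h x < - g x by rewrite -subr_lt0 opprK hg.
  have [H1 [H2 [n1 n2 a1 lt b1]]] := two_nonzero_between ab.
  have e1 : 0 < H1 - h x by rewrite subr_gt0.
  have e2 : 0 < - H2 - g x by rewrite subr_gt0 ltrNr.
  have [d1 d10 k1] := usc_enorm uh Dx e1.
  have [d2 d20 k2] := usc_enorm ug Dx e2.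
  exists (Num.min d1 d2 / 2); first by rewrite divr_gt0// lt_min d10.
  move=> y yx; exists H1, H2; split=> // w Dw wy.
  have : enorm (w - x) < Num.min d1 d2.
    apply: (le_lt_trans (enorm_triangle _ y _)).
    by rewrite [ltRHS](splitr (Num.min d1 d2)) ltrD.
  rewrite lt_min => /andP[/(k1 _ Dw) + /(k2 _ Dw)].
  by rewrite !(addrC _ (_ - _)) !subrK.
by exists r => // x Kx far; apply: hr.
Qed.

Lemma strict_absurd : (forall x, (O `|` GammaN O A) x -> h x + g x < 0) -> False.
Proof.
move=> /strict_gap_radius[r r0 hr].
(* [d / 8] keeps the balls away from [GammaD], and [r / 2] keeps them where [H1] and [H2]
   separate. *)
pose e := Num.min (d / 8) (r / 2).
have e0 : 0 < e by rewrite lt_min !divr_gt0.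
have ed : 8 * e <= d by rewrite mulrC -ler_pdivlMr// ge_min lexx.
have er : 2 * e <= r by rewrite mulrC -ler_pdivlMr// ge_min lexx orbT.
have [y [z [yz _]]] := max_pair_exists e0.
have [x [y' [z' [[Kx yx zx] far [Ky' yx' uy uyv my] [Kz' zx' vz vzu mz]]]]] :=
  pair_midpoint e0 ed yz.
have [Ky Kz _ _ _] := yz.
have far2 q : GammaD O A q -> d / 2 <= enorm (x - q).
  by move=> /far; apply: le_trans; exact: half_le_minus.
have [H1 [H2 [n1 n2 lt hw]]] := hr x Kx far2.
have dom w : closure O w -> enorm (w - x) < 2 * e -> (O `|` GammaN O A) w.
  by move=> Kw wx; apply: (far_domain far e0 ed) => //; exact: ltW.
have i1 := fu n1 e0 Kx (fun w Kw wx => conj (dom w Kw wx)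
  (proj1 (hw w (dom w Kw wx) (lt_le_trans wx er)))) my Ky yx.
have n2' : - H2 != 0 by rewrite oppr_eq0.
have i2 := fv n2' e0 Kx (fun w Kw wx => conj (dom w Kw wx)
  (proj2 (hw w (dom w Kw wx) (lt_le_trans wx er)))) mz Kz zx.
rewrite fdpN fdkN mulNr in i2.
(* For these increments [b <= d] and [c <= a] say that [(y', x)] and [(x, z')] do not beat
   [(y, z)]. *)
apply: (@strict_fd_absurd _ (fdp beta e) (fdk beta e) H1 H2
  (u y - u x) (u y' - u y) (v z' - v z) (v z - v x)) => //.
- exact: fdp01.
- exact: fdk_gt0.
- exact: lerB_cross.
- by apply: lerB_cross; rewrite addrC [leRHS]addrC.
- by rewrite [_ + (u y' - _)]addrC subrKA.
- by rewrite subrKA.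
Qed.

Lemma zero_absurd : (forall x, (O `|` GammaN O A) x -> h x <= 0) ->
  (forall x, (O `|` GammaN O A) x -> g x <= 0) -> False.
Proof.
move=> h0 g0.
pose e := d / 8.
have e0 : 0 < e by rewrite divr_gt0.
have ed : 8 * e <= d by rewrite /e mulrC divfK.
have [y [z [yz mxy]]] := max_pair_exists e0.
have [x [y' [z' [[Kx yx zx] far [Ky' yx' uy uyv my] [Kz' zx' vz vzu mz]]]]] :=
  pair_midpoint e0 ed yz.
have [Ky Kz _ Syz mx] := yz.
have dom t w : (forall q, GammaD O A q -> d - e <= enorm (t - q)) ->
    closure O w -> enorm (w - t) <= 2 * e -> (O `|` GammaN O A) w.
  by move=> fart Kw wx; apply: (far_domain fart e0 ed).
have i1 := fd_subsolution0 fu h0 e0 Kx (fun w Kw wx => dom x w far Kw (ltW wx)) my Ky yx.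
have i2 := fd_subsolution0 fv g0 e0 Kx (fun w Kw wx => dom x w far Kw (ltW wx)) mz Kz zx.
rewrite fdpN in i2.
have [|||||bd ca ab] := @fd_rigidity _ (fdp beta e)
  (u y - u x) (u y' - u y) (v z' - v z) (v z - v x).
- exact: fdp01.
- exact: lerB_cross.
- by apply: lerB_cross; rewrite addrC [leRHS]addrC.
- by rewrite [_ + (u y' - _)]addrC subrKA.
- by rewrite subrKA.
(* By rigidity [(y', x)] is a maximal pair too, so the choice of [y] gives [u y' <= u y]. *)
have b0 : u y' = u y.
  apply/le_anti; rewrite uy andbT; apply: (mxy y' x); split=> //.
  - by rewrite enormB.
  - apply: (le_trans Syz).
    by have -> : u y + v z = u y' + v x by rewrite -[u y'](subrK (u y)) bd; ring.
  move=> a1 a2 Ka1 Ka2 a12; apply: le_trans (mx _ _ Ka1 Ka2 a12) _.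
  by have -> : u y + v z = u y' + v x by rewrite -[u y'](subrK (u y)) bd; ring.
(* The last rigidity identity has become [(1 - fdp beta e) * (u y - u x) = 0]. *)
have ux : u x = u y.
  move: ab; rewrite b0 subrr mulr0 => /eqP; rewrite mulf_eq0 subr_eq0.
  by rewrite eq_sym lt_eqF ?fdp_lt1//= subr_eq0 => /eqP.
have vx : v x = v z by move: bd; rewrite b0 subrr => /esym/eqP; rewrite subr_eq0 => /eqP.
pose F t := [/\ closure O t, u t = u y & v t = v z].
(* With this radius the ball of radius [2 * r] about a point within [r] of [t] stays within [2 * e]
   of [t]. *)
pose r := 2 * e / 3.
have r0 : 0 < r by rewrite !divr_gt0// mulr_gt0.
have r3 : 2 * r + r = 2 * e by rewrite /r; field.
(* Neither function exceeds its constant near [F], since [(s, t)] or [(t, s)] would then beat the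
   maximum. *)
have Fball t : F t -> forall s, closure O s -> enorm (s - t) <= 2 * e ->
    [/\ (O `|` GammaN O A) s, u s <= u y & v s <= v z].
  move=> [Kt ut vt] s Ks st; split.
  - apply: (dom t) => //; apply: (far_boundary Kt Kt); rewrite ?subrr ?enorm0 ?(ltW e0)//.
    by rewrite ut vt.
  - by have := mx s t Ks Kt; rewrite enormB st => /(_ isT); rewrite vt lerD2r.
  - by have := mx t s Kt Ks st; rewrite ut lerD2l.
have Fstep t s : F t -> closure O s -> enorm (s - t) <= r -> F s.
  move=> Ft Ks st; have [Kt ut vt] := Ft.
  have inb w : enorm (w - s) <= 2 * r -> enorm (w - t) <= 2 * e.
    by move=> ws; rewrite -r3 (le_trans (enorm_triangle _ s _))// lerD.
  have ts : enorm (t - s) <= r by rewrite enormB.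
  have st2 : enorm (s - t) <= 2 * e by apply: (le_trans st); rewrite -r3 lerDr mulr_ge0// ltW.
  have [_ us vs] := Fball t Ft s Ks st2.
  (* The inequality centred at [s] and evaluated back at [t] bounds [u y - u s] by [fdp beta r < 1]
     times itself. *)
  have j1 := fd_subsolution0 (m := u y) fu h0 r0 Ks
    (fun w Kw ws => let: And3 a _ _ := Fball t Ft w Kw (inb w (ltW ws)) in a)
    (fun w Kw ws => let: And3 _ a _ := Fball t Ft w Kw (inb w ws) in a) Kt ts.
  have j2 := fd_subsolution0 (m := v z) fv g0 r0 Ks
    (fun w Kw ws => let: And3 a _ _ := Fball t Ft w Kw (inb w (ltW ws)) in a)
    (fun w Kw ws => let: And3 _ _ a := Fball t Ft w Kw (inb w ws) in a) Kt ts.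
  have contract (a k : R) : k < 1 -> 0 <= a -> a <= k * a -> a = 0.
    move=> k1 a0 ak; apply/le_anti; rewrite a0 andbT.
    have : (1 - k) * a <= 0 by rewrite mulrBl mul1r subr_le0.
    by rewrite pmulr_rle0// subr_gt0.
  rewrite ut in j1; rewrite vt in j2; split=> //; apply/eqP; rewrite eq_sym -subr_eq0; apply/eqP.
  - by apply: contract j1; rewrite ?fdp_lt1// subr_ge0.
  - by apply: contract j2; rewrite ?fdp_lt1// subr_ge0.
have Fx : F x by [].
(* [Fstep] has the same radius everywhere, so [F] is relatively open and closed in the connected set
   [O]. *)
have OF : O `&` F = O.
  have opn (P : set V) : open [set t | exists2 s, P s & enorm (t - s) < r].
    rewrite openE => t [s Ps ts]; apply/nbhs_enormP.
    exists (r - enorm (t - s)); first by rewrite subr_gt0.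
    move=> t' t't; exists s => //; apply: (le_lt_trans (enorm_triangle _ t _)).
    by rewrite -ltrBrDr.
  apply: cO.
  - have [t Ot tx] := closure_enorm Kx r0.
    exists t; split=> //; apply: Fstep Fx _ (ltW tx); exact: subset_closure.
  - exists [set t | exists2 s, F s & enorm (t - s) < r]; first exact: opn.
    apply/seteqP; split=> t [Ot Ft]; split=> //.
      by exists t => //; rewrite subrr enorm0.
    case: Ft => s Fs ts; apply: Fstep Fs _ (ltW ts); exact: subset_closure.
  - exists (~` [set t | exists2 s, (O `&` ~` F) s & enorm (t - s) < r]).
      by apply: open_closedC; exact: opn.
    apply/seteqP; split=> t [Ot Ft]; split=> //.
      move=> [s [Os nFs] ts]; apply: nFs; apply: (Fstep _ _ Ft).
        exact: subset_closure.
      by rewrite enormB ltW.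
    apply: contrapT => nFt; apply: Ft; exists t => //.
    by rewrite subrr enorm0.
(* One more step from a point of [O] near [q] carries the constants to [GammaD], against [hD]. *)
have [q Dq] := D0.
have Kq : closure O q by case: Dq => -[].
have [t Ot tq] := closure_enorm Kq r0.
have [_ Ft] : (O `&` F) t by rewrite OF.
have [_ uq vq] : F q by apply: (Fstep _ _ Ft Kq); rewrite enormB ltW.
have := hD Dq; rewrite uq vq leNgt => /negP; apply.
exact: lt_le_trans mp Syz.
Qed.

End Comparison.
End Discrete.

(** * Comparison for finite difference and viscosity solutions *)

Lemma usc_onZ {R : realType} {n : nat} (S : set 'rV[R]_n) (f : 'rV[R]_n -> R) (k : R) :
  0 < k -> usc_on S f -> usc_on S (fun x => k * f x).
Proof.
move=> k0 uf x Sx e e0; have [d d0 hd] := uf x Sx (e / k) (divr_gt0 e0 k0).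
exists d => // y Sy yd; have := hd y Sy yd.
by rewrite -(ltr_pM2l k0) mulrDr mulrCA divff ?gt_eqF// mulr1.
Qed.

Lemma usc_onD {R : realType} {n : nat} (S : set 'rV[R]_n) (f g : 'rV[R]_n -> R) :
  usc_on S f -> usc_on S g -> usc_on S (fun x => f x + g x).
Proof.
move=> uf ug x Sx e e0; have e2 : 0 < e / 2 by rewrite divr_gt0.
have [d d0 hd] := uf x Sx _ e2; have [d' d'0 hd'] := ug x Sx _ e2.
exists (Num.min d d'); first by rewrite lt_min d0.
move=> y Sy; rewrite lt_min => /andP[yd yd'].
by rewrite [e]splitr addrACA ltrD ?hd ?hd'.
Qed.

Lemma fd_comparison {R : realType} {n : nat} (O A : set 'rV[R]_n) (beta m : R)
    (h g u v : 'rV[R]_n -> R) :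
  open O -> connected O -> bounded_setV O -> open A -> GammaD O A !=set0 ->
  (GammaN O A !=set0 -> convex_setV O) ->
  usc_on (closure O) u -> usc_on (closure O) v ->
  usc_on (O `|` GammaN O A) h -> usc_on (O `|` GammaN O A) g ->
  fd_subsolution O A beta h u -> fd_subsolution O A (- beta) g v ->
  (forall x, (O `|` GammaN O A) x -> h x + g x < 0) \/
  (forall x, (O `|` GammaN O A) x -> h x <= 0 /\ g x <= 0) ->
  (forall q, GammaD O A q -> u q + v q <= m) ->
  forall x, closure O x -> u x + v x <= m.
Proof.
move=> oO cO bO oA D0 convN uu uv uh ug fu fv hg hD p Kp.
rewrite leNgt; apply/negP => mp.
have [d d0 sep] := boundary_separation oO bO oA uu uv hD mp.
case: hg => [lt|le].
  exact: (strict_absurd oO bO convN uu uv uh ug fu fv Kp d0 sep lt).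
by apply: (zero_absurd oO cO bO D0 convN uu uv fu fv hD Kp mp d0 sep) => x /le[].
Qed.

Theorem theorem2p3 (R : realType) (n : nat) (Omega A : set 'rV[R]_n)
    (nu : 'rV[R]_n -> 'rV[R]_n) (beta : R) (h ht u v : 'rV[R]_n -> R) :
  open Omega -> connected Omega -> bounded_setV Omega ->
  C1_boundary_normal Omega nu ->
  open A -> GammaD Omega A !=set0 ->
  (GammaN Omega A !=set0 -> convex_setV Omega) ->
  bounded_on (Omega `|` GammaN Omega A) h ->
  bounded_on (Omega `|` GammaN Omega A) ht ->
  usc_on (Omega `|` GammaN Omega A) h ->
  lsc_on (Omega `|` GammaN Omega A) ht ->
  (forall x, (Omega `|` GammaN Omega A) x -> h x <= ht x) ->
  [\/ (forall x, (Omega `|` GammaN Omega A) x -> h x < ht x),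
      (forall x, (Omega `|` GammaN Omega A) x -> h x = 0) |
      (forall x, (Omega `|` GammaN Omega A) x -> 0 < ht x)] ->
  subsolution Omega A nu beta h u ->
  supersolution Omega A nu beta ht v ->
  exists m : R, is_max_on (closure Omega) (fun x => u x - v x) m /\
                is_max_on (GammaD Omega A) (fun x => u x - v x) m.
Proof.
move=> oO cO bO hnu oA D0 convN _ _ uh lht hht alt su sv.
(* In dimension [0] the space is one point, so a nonempty [Omega] has no boundary. *)
have n0 : (0 < n)%N.
  rewrite ltnNge; apply/negP => n0; have [q [[Kq nq] _]] := D0.
  have [y Oy _] := closure_enorm Kq ltr01.
  apply: nq; have -> : q = y.
    by apply/rowP => i; have := leq_trans (ltn_ord i) n0; rewrite ltn0.
  exact: open_nbhs_nbhs.
have nuO c w : Omega c -> GammaN Omega A w -> 0 < dotp (w - c) (nu w).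
  move=> Oc Nw; have cvO : convex_setV Omega by apply: convN; exists w.
  exact: (outward_normal_gt0 oO cvO hnu (proj1 Nw) Oc).
have sw := supersolution_opp sv.
set w := fun x => - v x in sw; set g := fun x => - ht x in sw.
have fu : fd_subsolution Omega A beta h u.
  move=> x H m e z H0 e0 Kx reg um Kz ze.
  exact: (finite_difference oO bO nuO su n0 H0 e0 Kx reg um Kz ze).
have fw : fd_subsolution Omega A (- beta) g w.
  move=> x H m e z H0 e0 Kx reg um Kz ze.
  exact: (finite_difference oO bO nuO sw n0 H0 e0 Kx reg um Kz ze).
have [uu _] := su; have [uw _] := sw.
have key m : (forall q, GammaD Omega A q -> u q + w q <= m) ->
    forall x, closure Omega x -> u x + w x <= m.
  case: alt => [lt|h0|ht0] hD.
  - apply: (fd_comparison oO cO bO oA D0 convN uu uw uh lht fu fw _ hD).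
    by left=> x Dx; rewrite subr_lt0 lt.
  - apply: (fd_comparison oO cO bO oA D0 convN uu uw uh lht fu fw _ hD).
    by right=> x Dx; rewrite h0// oppr_le0 -(h0 x Dx) hht.
  move=> x Kx.
  have [y Ky my] := usc_on_max uw (fun _ => id) (bounded_compact_closure bO)
    (ex_intro _ x Kx).
  apply/ler_addgt0Pr => e e0.
  have c0 : 0 < w y - w x + 1 by rewrite ltr_wpDl// subr_ge0 my.
  (* Replacing [w] by [(1 + t) * w] costs [t * (w y - w x) <= e]; the added [1] keeps the
     denominator positive. *)
  pose t := e / (w y - w x + 1).
  have t0 : 0 < t by rewrite divr_gt0.
  have k0 : 0 < 1 + t by rewrite addr_gt0.
  have k1 z : (1 + t) * w z = w z + t * w z by rewrite mulrDl mul1r.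
  have kD q : GammaD Omega A q -> u q + (1 + t) * w q <= m + t * w y.
    move=> Dq; rewrite k1 addrA lerD ?hD// ler_wpM2l ?(ltW t0)// my//.
    by case: Dq => -[].
  (* Scaling adds [- t * ht z < 0] to the weak inequality [h <= ht]. *)
  have klt z : (Omega `|` GammaN Omega A) z -> h z + (1 + t) * g z < 0.
    move=> Dz; have -> : h z + (1 + t) * g z = (h z - ht z) - t * ht z by rewrite /g; ring.
    by rewrite subr_lt0 (le_lt_trans _ (mulr_gt0 t0 (ht0 z Dz)))// subr_le0 hht.
  have := fd_comparison oO cO bO oA D0 convN uu (usc_onZ k0 uw) uh (usc_onZ k0 lht) fu
    (fd_subsolutionZ k0 fw) (or_introl klt) kD Kx.
  rewrite k1 addrA -lerBrDr => /le_trans; apply; rewrite -addrA lerD2l -mulrBr.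
  by rewrite /t mulrAC ler_pdivrMr// ler_pM2l// lerDl.
have Dcl q : GammaD Omega A q -> closure Omega q by case=> -[].
(* The maximum over the compact set [GammaD] is attained, and [key] makes it a bound on the whole
   closure. *)
have [q Dq mq] := usc_on_max (usc_onD uu uw) Dcl (compact_GammaD oO bO oA) D0.
exists (u q - v q); split; split.
- by exists q => //; exact: Dcl.
- exact: key mq.
- by exists q.
- exact: mq.
Qed.
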